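(* Let $(\mathcal{M},\tau)$ be a von Neumann algebra with a normal faithful tracial state, $\mathcal{N}\subset\mathcal{M}$ a von Neumann subalgebra, and let $\mathcal{N}\subset A_j\subset\mathcal{M}$, $j=1,\dots,n$, be von Neumann subalgebras that are successively independent over $\mathcal{N}$. Let $a_j\in A_j$ be self-adjoint and let $\sigma_j,M_j\ge 0$ be real numbers with $\sum_{j=1}^n\sigma_j^2>0$ and $\sup_{j}M_j>0$, such that for every $j$: (i) $E_{\mathcal{N}}(a_j)=0$; (ii) $E_{\mathcal{N}}(a_j^2)\le\sigma_j^2$; (iii) $\|a_j\|\le M_j$. Then for every $t\ge 0$, $$\tau\Big(1_{[t,\infty)}\Big(\sum_{j=1}^n a_j\Big)\Big)\le\exp\left(-\frac{\sum_{j=1}^n\sigma_j^2}{\sup_{j=1,\dots,n}M_j^2}\,\phi\left(\frac{t\,\sup_{j=1,\dots,n}M_j}{\sum_{j=1}^n\sigma_j^2}\right)\right),$$ where $\phi(x)=(1+x)\log(1+x)-x$.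
   Context: $\tau$ is a state with $\tau(1)=1$ and $\tau(xy)=\tau(yx)$. $E_{\mathcal{N}}:\mathcal{M}\to\mathcal{N}$ denotes the unique $\tau$-preserving conditional expectation: $E_{\mathcal{N}}(1)=1$ and $E_{\mathcal{N}}(axb)=aE_{\mathcal{N}}(x)b$ for $a,b\in\mathcal{N}$, $x\in\mathcal{M}$. Two subalgebras $\mathcal{N}\subset A,B\subset\mathcal{M}$ are independent over $\mathcal{N}$ if $E_{\mathcal{N}}(ab)=E_{\mathcal{N}}(a)E_{\mathcal{N}}(b)$ for all $a\in A$, $b\in B$. The subalgebras $A_1,\dots,A_n$ are successively independent over $\mathcal{N}$ if, for each $1\le k<n$, $A_{k+1}$ is independent over $\mathcal{N}$ of the algebra generated by $A_1,\dots,A_k$. $\|\cdot\|$ is the operator norm. For self-adjoint $a$ with spectral decomposition $a=\int t\,dE_t$, $1_I(a)=\int_I dE_t$ is the spectral projection of $a$ corresponding to $I$. *)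

(* Defs.v *)
From HB Require Import structures.
From mathcomp Require Import all_boot all_order all_algebra.
From mathcomp Require Import all_classical all_reals all_analysis.
From mathcomp.real_closed Require Import complex.

Set Implicit Arguments.
Unset Strict Implicit.
Unset Printing Implicit Defensive.

Import Order.TTheory GRing.Theory Num.Theory.
Import numFieldNormedType.Exports.

Local Open Scope classical_set_scope.
Local Open Scope ring_scope.
Local Open Scope complex_scope.

(* A complex Hilbert space: a complex Banach space whose norm comes from an
   inner product, which is linear in its first argument. *)
Record hilbertType (R : realType) := HilbertType {
  hilbert_space :> completeNormedModType R[i];
  inner : {dot hilbert_space for (@Num.conj R[i])};
  innerE : forall u : hilbert_space, inner u u = `|u| ^+ 2
}.
Arguments inner {R _}.

Section BoundedOperators.
Context {R : realType} {H : hilbertType R}.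

(* For linear maps between normed spaces, continuous means bounded. *)
Definition bounded_linear : {pred H -> H} :=
  fun f => `[< linear f /\ continuous f >].

Lemma bounded_linearP (f : H -> H) :
  reflect (linear f /\ continuous f) (f \in bounded_linear).
Proof. exact: asboolP. Qed.

Lemma bounded_linear_submod : submod_closed bounded_linear.
Proof.
split=> [|c f g /bounded_linearP[fl fc] /bounded_linearP[gl gc]].
  apply/bounded_linearP; split=> [c u v|u]; last exact: cst_continuous.
  by rewrite /= scaler0 addr0.
apply/bounded_linearP; split=> [d u v|u].
  by rewrite !fctE fl gl !scalerDr !scalerA mulrC addrACA.
by apply: cvgD; [apply: cvgZl_tmp; exact: fc|exact: gc].
Qed.

HB.instance Definition _ :=
  GRing.isSubmodClosed.Build _ _ bounded_linear bounded_linear_submod.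

End BoundedOperators.

(* The algebra B(H) of bounded operators on H, with composition as product. *)
Record bounded_operator (R : realType) (H : hilbertType R) := BoundedOperator {
  op_fun :> H -> H;
  _ : op_fun \in bounded_linear
}.

Section BoundedOperatorAlgebra.
Context {R : realType} {H : hilbertType R}.
Local Notation B := (bounded_operator H).

HB.instance Definition _ := [isSub of B for @op_fun R H].
HB.instance Definition _ := [Choice of B by <:].
HB.instance Definition _ := [SubChoice_isSubLmodule of B by <:].

Lemma op_linear (x : B) : linear x.
Proof. by have /bounded_linearP[] := valP x. Qed.

Lemma op_continuous (x : B) : continuous x.
Proof. by have /bounded_linearP[] := valP x. Qed.

HB.instance Definition _ (x : B) :=
  GRing.isLinear.Build R[i] H H _ (op_fun x) (op_linear x).

Lemma id_bounded_linear : (id : H -> H) \in bounded_linear.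
Proof. by apply/bounded_linearP; split=> [c u v|u] //; exact: cvg_id. Qed.

Lemma comp_bounded_linear (x y : B) : x \o y \in bounded_linear.
Proof.
apply/bounded_linearP; split=> [c u v|u]; first by rewrite /= !linearP.
by apply: continuous_comp; exact: op_continuous.
Qed.

Definition op_one : B := BoundedOperator id_bounded_linear.
Definition op_mul (x y : B) : B := BoundedOperator (comp_bounded_linear x y).

Lemma bounded_operatorP (x y : B) : (forall u, x u = y u) -> x = y.
Proof. by move=> xy; apply/val_inj/funext. Qed.

Lemma op_addE (x y : B) u : (x + y) u = x u + y u. Proof. by []. Qed.

Lemma op_scaleE c (x : B) u : (c *: x) u = c *: x u. Proof. by []. Qed.

Lemma op_mulA : associative op_mul.
Proof. by move=> x y z; apply: bounded_operatorP. Qed.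

Lemma op_mul1l : left_id op_one op_mul.
Proof. by move=> x; apply: bounded_operatorP. Qed.

Lemma op_mul1r : right_id op_one op_mul.
Proof. by move=> x; apply: bounded_operatorP. Qed.

Lemma op_mulDl : left_distributive op_mul +%R.
Proof. by move=> x y z; apply: bounded_operatorP. Qed.

Lemma op_mulDr : right_distributive op_mul +%R.
Proof. by move=> x y z; apply: bounded_operatorP => u /=; rewrite linearD. Qed.

HB.instance Definition _ := GRing.Zmodule_isPzRing.Build B
  op_mulA op_mul1l op_mul1r op_mulDl op_mulDr.

Lemma op_scaleAl c (x y : B) : c *: (x * y) = c *: x * y.
Proof. exact: bounded_operatorP. Qed.

Lemma op_scaleAr c (x y : B) : c *: (x * y) = x * (c *: y).
Proof. by apply: bounded_operatorP => u; rewrite /= linearZ. Qed.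

Lemma op_mulE (x y : B) u : (x * y) u = x (y u). Proof. by []. Qed.

Lemma op_oneE u : (1 : B) u = u. Proof. by []. Qed.

End BoundedOperatorAlgebra.

Section VonNeumannAlgebras.
Context {R : realType} {H : hilbertType R}.
Local Notation B := (bounded_operator H).
Implicit Types (x y : B) (A D M N S : set B).

Definition is_adjoint x y := forall u v, inner (x u) v = inner u (y v).

Definition self_adjoint x := is_adjoint x x.

(* The order on R[i] makes [0 <= z] mean that z is real and nonnegative. *)
Definition op_ge0 x := forall u, 0 <= inner (x u) u.

Definition op_le x y := op_ge0 (y - x).

Definition op_norm x : R := sup [set complex.Re `|x u| | u in [set u : H | `|u| <= 1]].

Definition commutant S : set B := [set y | forall x, S x -> x * y = y * x].

Definition von_neumann_algebra M :=
  (forall x, M x -> exists2 y, M y & is_adjoint x y) /\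
  commutant (commutant M) = M.

Definition subalgebra A :=
  [/\ A 1, forall (c : R[i]) x y, A x -> A y -> A (c *: x + y) &
      forall x y, A x -> A y -> A (x * y)].

Definition generated_algebra S : set B :=
  \bigcap_(A in [set A | subalgebra A /\ S `<=` A]) A.

Definition op_directed D :=
  D !=set0 /\
  forall x y, D x -> D y -> exists z, [/\ D z, op_le x z & op_le y z].

Definition self_adjoint_part M : set B := M `&` self_adjoint.

Definition is_op_sup M D x :=
  [/\ self_adjoint_part M x, forall y, D y -> op_le y x &
      forall z, self_adjoint_part M z -> (forall y, D y -> op_le y z) ->
        op_le x z].

(* Only the restriction of [tau] to [M] is relevant.  Normality is
   preservation of suprema of directed families of self-adjoint elements. *)
Record normal_faithful_tracial_state M (tau : B -> R[i]) : Prop := {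
  state_linear : forall (c : R[i]) x y, M x -> M y ->
    tau (c *: x + y) = c * tau x + tau y;
  state_ge0 : forall x, M x -> op_ge0 x -> 0 <= tau x;
  state1 : tau 1 = 1;
  state_tracial : forall x y, M x -> M y -> tau (x * y) = tau (y * x);
  state_faithful : forall x, M x -> op_ge0 x -> tau x = 0 -> x = 0;
  state_normal : forall D x, D `<=` self_adjoint_part M -> op_directed D ->
    is_op_sup M D x ->
    forall c : R[i], (forall y, D y -> tau y <= c) -> tau x <= c
}.

(* For a normal faithful tracial state [tau] and a von Neumann subalgebra [N]
   of [M], there is exactly one such [E], up to its values outside [M]. *)
Record conditional_expectation M N (tau : B -> R[i]) (E : B -> B) : Prop := {
  ce_sub : forall x, M x -> N (E x);
  ce_linear : forall (c : R[i]) x y, M x -> M y ->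
    E (c *: x + y) = c *: E x + E y;
  ce_ge0 : forall x, M x -> op_ge0 x -> op_ge0 (E x);
  ce1 : E 1 = 1;
  ce_bimodule : forall a x b, N a -> M x -> N b -> E (a * x * b) = a * E x * b;
  ce_preserving : forall x, M x -> tau (E x) = tau x
}.

Definition independent (E : B -> B) A A' :=
  forall a b, A a -> A' b -> E (a * b) = E a * E b.

Definition successively_independent (E : B -> B) n (A : 'I_n -> set B) :=
  forall k : 'I_n, (0 < k)%N ->
    independent E (A k)
      (generated_algebra (\bigcup_(i in [set i : 'I_n | (i < k)%N]) A i)).

(* [P] is a projection-valued measure on the Borel sets of the line such that
   a = \int s dP(s), the integral being taken weakly.  By the spectral theorem
   a self-adjoint [a] has exactly one such [P], up to its values on
   non-measurable sets, and [P I] is the spectral projection 1_I(a).  The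
   countable additivity of [P] is that of the scalar measures [mu]. *)
Record spectral_measure (a : B) (P : set (measurableTypeR R) -> B) : Prop := {
  sm_projection : forall I, measurable I ->
    self_adjoint (P I) /\ P I * P I = P I;
  smT : P setT = 1;
  smI : forall I J, measurable I -> measurable J -> P (I `&` J) = P I * P J;
  sm_integral : forall u : H,
    exists mu : {measure set (measurableTypeR R) -> \bar R},
      [/\ forall I, measurable I -> mu I = (complex.Re (inner (P I u) u))%:E,
          mu.-integrable setT (fun s : measurableTypeR R => (s : R)%:E) &
          inner (a u) u = (\int[mu]_s (s : R))%:C]
}.

End VonNeumannAlgebras.

Definition bennett_phi {R : realType} (x : R) : R := (1 + x) * ln (1 + x) - x.

(* Main.v *)
Require Import Defs.
From HB Require Import structures.
From mathcomp Require Import all_boot all_order all_algebra.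
From mathcomp Require Import all_classical all_reals all_analysis.
From mathcomp.real_closed Require Import complex.
From mathcomp Require Import ring lra.

Set Implicit Arguments.
Unset Strict Implicit.
Unset Printing Implicit Defensive.

Import Order.TTheory GRing.Theory Num.Theory.
Import numFieldNormedType.Exports.

Local Open Scope classical_set_scope.
Local Open Scope ring_scope.
Local Open Scope complex_scope.

(** The proof is the Laplace transform method.  Let S = a_1 + ... + a_n, let V
    be the sum of the sigma_j^2 and m the largest of the M_j.  For lambda >= 0,

      e^(lambda t) tau(1_[t,oo)(S)) <= tau(e^(lambda S)) <= e^(c V),
      where c = (e^(lambda m) - 1 - lambda m) / m^2,

    and the choice lambda = ln(1 + t m / V) / m turns this into the bound with
    phi ([bennett_exponent]).  The middle quantity is bounded one summand at a
    time: by the Golden-Thompson inequality, tau(e^(lambda (S_k + a))) is at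
    most tau(e^(lambda a) e^(lambda S_k)), independence replaces e^(lambda a)
    by E(e^(lambda a)), and the latter is at most 1 + c sigma^2 because
    e^(lambda a) <= 1 + lambda a + c a^2 and E(a) = 0.

    Operator exponentials are replaced throughout by the Euler approximations
    (1 + lambda S / K)^K with K = 2^p.  These are polynomials in S, so they
    belong to the algebras at hand, and only their traces are taken to the
    limit.  For powers of two the Golden-Thompson inequality has an exact
    form: tau((x y)^K) <= tau(x^K y^K) for self-adjoint x and y
    ([trace_power]).  As (1 + h S)(1 + h a) differs from 1 + h (S + a) by
    h^2 S a with h = lambda / K, using it costs an error of order 1 / K
    ([golden_thompson_approx]).

    On the spectral side, a weak integral representation of S is all that is
    given, so the basic facts of spectral theory are derived from it: the
    projections P(I) commute with S and bound its quadratic form on their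
    ranges, and P([t,oo)) commutes with everything that commutes with S
    ([spectral_commutant]), hence lies in M, where tau is a trace.  The Markov
    inequality then reads (1 + h t)^K P([t,oo)) <= (1 + h S)^K
    ([spectral_power_ge]). *)

(** * The underlying real inner product space *)

Section RealInnerProduct.
Context {R : realType} {H : hilbertType R}.
Implicit Types (u v w : H) (r : R).

(** The operators that occur are compared through their quadratic forms, for
    which the underlying real Hilbert space is enough; it keeps the complex
    numbers out of all estimates. *)
Definition ip u v : R := complex.Re (inner u v).

(** The norm of a complex normed module takes its values in [R[i]]. *)
Definition nrm u : R := complex.Re `|u|.

Lemma ReD (a b : R[i]) : complex.Re (a + b) = complex.Re a + complex.Re b.
Proof. by case: a; case: b. Qed.

Lemma ReZ r (a : R[i]) : complex.Re (r%:C * a) = r * complex.Re a.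
Proof. by case: a => x y /=; rewrite mul0r subr0. Qed.

Lemma ipDl u v w : ip (u + v) w = ip u w + ip v w.
Proof. by rewrite /ip linearDl ReD. Qed.

Lemma ipZl r u v : ip (r%:C *: u) v = r * ip u v.
Proof. by rewrite /ip linearZl_LR ReZ. Qed.

Lemma ipC u v : ip u v = ip v u.
Proof.
have ReJ (a : R[i]) : complex.Re (Num.conj a) = complex.Re a by case: a.
by rewrite /ip hermC expr0 mul1r; exact: ReJ.
Qed.

Lemma ip0l v : ip 0 v = 0.
Proof. by rewrite /ip linear0l. Qed.

Lemma ipNl u v : ip (- u) v = - ip u v.
Proof. by apply/eqP; rewrite -addr_eq0 -ipDl addNr ip0l. Qed.

Lemma ipBl u v w : ip (u - v) w = ip u w - ip v w.
Proof. by rewrite ipDl ipNl. Qed.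

Lemma ipDr u v w : ip w (u + v) = ip w u + ip w v.
Proof. by rewrite ipC ipDl !(ipC w). Qed.

Lemma ipBr u v w : ip w (u - v) = ip w u - ip w v.
Proof. by rewrite ipC ipBl !(ipC w). Qed.

Lemma ipZr r u v : ip u (r%:C *: v) = r * ip u v.
Proof. by rewrite ipC ipZl ipC. Qed.

Lemma ip0r v : ip v 0 = 0.
Proof. by rewrite ipC ip0l. Qed.

Lemma nrmE u : (nrm u)%:C = `|u|.
Proof. by rewrite /nrm RRe_real // normr_real. Qed.

Lemma nrm_ge0 u : 0 <= nrm u.
Proof. by rewrite -lecR nrmE normr_ge0. Qed.

Lemma inner_self u : inner u u = (nrm u ^+ 2)%:C.
Proof. by rewrite innerE -nrmE rmorphXn. Qed.

Lemma ip_self u : ip u u = nrm u ^+ 2.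
Proof. by rewrite /ip inner_self. Qed.

Lemma nrm0 : nrm 0 = 0.
Proof. by rewrite /nrm normr0. Qed.

Lemma nrm_eq0 u : nrm u = 0 -> u = 0.
Proof. by move=> u0; apply/normr0_eq0; rewrite -nrmE u0. Qed.

Lemma nrm_gt0 u : u != 0 -> 0 < nrm u.
Proof.
move=> u0; rewrite lt_neqAle nrm_ge0 eq_sym andbT.
by apply: contra_neq u0; exact: nrm_eq0.
Qed.

Lemma nrmD u v : nrm (u + v) <= nrm u + nrm v.
Proof. by rewrite -lecR rmorphD /= !nrmE ler_normD. Qed.

Lemma nrmZ r u : nrm (r%:C *: u) = `|r| * nrm u.
Proof.
apply: (@complexI R); rewrite rmorphM /= !nrmE normrZ; congr (_ * _).
by rewrite normc_def /= expr0n addr0 sqrtr_sqr.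
Qed.

Lemma nrmN u : nrm (- u) = nrm u.
Proof. by rewrite /nrm normrN. Qed.

Lemma ip_CS u v : ip u v <= nrm u * nrm v.
Proof.
have [->|u0] := eqVneq u 0; first by rewrite ip0l nrm0 mul0r.
have [->|v0] := eqVneq v 0; first by rewrite ip0r nrm0 mulr0.
have := sqr_ge0 (nrm ((nrm v)%:C *: u - (nrm u)%:C *: v)).
rewrite -ip_self !(ipBl, ipBr, ipZl, ipZr) !ip_self (ipC v u).
move: (nrm_gt0 u0) (nrm_gt0 v0); set a := nrm u; set b := nrm v; set c :=
  ip u v.
move=> a0 b0.
have : 0 < a * b by rewrite mulr_gt0.
nra.
Qed.

Lemma ip_CSn u v : - (nrm u * nrm v) <= ip u v.
Proof. by rewrite lerNl -ipNl (le_trans (ip_CS _ _)) ?nrmN. Qed.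

Lemma ipP u v : (forall w, ip u w = ip v w) -> u = v.
Proof.
move=> uv; apply/eqP; rewrite -subr_eq0; apply/eqP/nrm_eq0/eqP.
by rewrite -sqrf_eq0 -ip_self ipBl uv subrr.
Qed.

End RealInnerProduct.

(** * Adjoints, positivity and bounds of operators *)

Section Operators.
Context {R : realType} {H : hilbertType R}.
Local Notation B := (bounded_operator H).
Implicit Types (x y z p q : B) (u v w : H) (r : R) (S A : set B).

Lemma op_subE x y u : (x - y) u = x u - y u. Proof. by []. Qed.

Lemma ip_adjoint x y u v : is_adjoint x y -> ip (x u) v = ip u (y v).
Proof. by rewrite /ip => ->. Qed.

(** The imaginary part of an inner product is, up to sign, the real part of the
    inner product with the first vector multiplied by [i]. *)
Lemma is_adjoint_ip x y :
  (forall u v, ip (x u) v = ip u (y v)) -> is_adjoint x y.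
Proof.
move=> xy u v; apply/eqP; rewrite eq_complex; apply/andP; split; apply/eqP.
  exact: xy.
have ImE (a : R[i]) : complex.Im a = - complex.Re ('i * a).
  by case: a => a b /=; rewrite mul0r mul1r sub0r opprK.
by rewrite !ImE -!linearZl_LR -linearZ; congr (- _); exact: xy.
Qed.

Lemma is_adjointC x y : is_adjoint x y -> is_adjoint y x.
Proof.
by move=> xy; apply: is_adjoint_ip => u v; rewrite ipC -(ip_adjoint _ _ xy) ipC.
Qed.

Lemma is_adjointM x x' y y' :
  is_adjoint x x' -> is_adjoint y y' -> is_adjoint (x * y) (y' * x').
Proof. by move=> hx hy u v; rewrite !op_mulE hx hy. Qed.

Lemma is_adjointD x x' y y' :
  is_adjoint x x' -> is_adjoint y y' -> is_adjoint (x + y) (x' + y').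
Proof.
by move=> hx hy; apply: is_adjoint_ip => u v; rewrite !op_addE ipDl ipDr
  (ip_adjoint _ _ hx) (ip_adjoint _ _ hy).
Qed.

Lemma is_adjointZ r x x' : is_adjoint x x' ->
  is_adjoint (r%:C *: x) (r%:C *: x').
Proof.
by move=> hx; apply: is_adjoint_ip => u v; rewrite !op_scaleE ipZl ipZr
  (ip_adjoint _ _ hx).
Qed.

Lemma is_adjoint1 : is_adjoint (1 : B) 1.
Proof. by []. Qed.

Lemma is_adjointN x x' : is_adjoint x x' -> is_adjoint (- x) (- x').
Proof.
move=> hx; have := is_adjointZ (-1) hx.
by rewrite !rmorphN1 !scaleN1r.
Qed.

Lemma is_adjointX x x' k : is_adjoint x x' -> is_adjoint (x ^+ k) (x' ^+ k).
Proof.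
move=> hx; elim: k => [|k IH]; first by rewrite !expr0.
by rewrite exprS exprSr; exact: is_adjointM.
Qed.

Lemma self_adjoint0 : self_adjoint (0 : B).
Proof. by apply: is_adjoint_ip => u v; rewrite ip0l ip0r. Qed.

Lemma op_ge0P x : self_adjoint x -> (forall u, 0 <= ip (x u) u) -> op_ge0 x.
Proof.
move=> xs x0 u; rewrite lecE /= x0 andbT.
have : inner (x u) u = Num.conj (inner (x u) u).
  by rewrite {1}xs hermC expr0 mul1r.
by case: (inner (x u) u) => a b [/eqP]; rewrite -subr_eq0 opprK -mulr2n
  mulrn_eq0.
Qed.

Lemma op_bounded x : exists2 K : R, 0 <= K & forall u, nrm (x u) <= K * nrm u.
Proof.
have /linear_boundedP/pinfty_ex_gt0[K K0 xK] : bounded_near x (nbhs (0 : H)).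
exact/continuous_linear_bounded/op_continuous.
have KE : K = (complex.Re K)%:C by rewrite RRe_real ?gtr0_real.
exists (complex.Re K) => [|u]; first by rewrite -lecR -KE ltW.
by rewrite -lecR rmorphM /= !nrmE -KE xK.
Qed.

End Operators.

Section Bounds.
Context {R : realType} {H : hilbertType R}.
Local Notation B := (bounded_operator H).
Implicit Types (x y z p q : B) (u v w : H) (r : R) (S A : set B).

(** A relation, not the operator norm itself: sums, products and powers then
    only need upper bounds. *)
Definition bounded_by x (K : R) := forall u, nrm (x u) <= K * nrm u.

(** The supremum defining [op_norm] is over a bounded set because a continuous
    linear map is bounded; otherwise [sup] would carry no information. *)
Lemma op_norm_bound x r : op_norm x <= r -> bounded_by x r.
Proof.
move=> xr u; have [->|u0] := eqVneq u 0; first by rewrite linear0 nrm0 mulr0.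
have nu0 := nrm_gt0 u0.
have [K K0 xK] := op_bounded x.
pose v := (nrm u)^-1%:C *: u.
have nv : nrm v = 1.
  by rewrite nrmZ ger0_norm ?invr_ge0 ?nrm_ge0 // mulVf // gt_eqF.
have : nrm (x v) <= r.
  apply: le_trans xr; apply: ub_le_sup; last first.
    by exists v => //=; rewrite -nrmE nv.
  exists K => _ [w /= w1 <-]; apply: le_trans (xK w) _.
  by rewrite ler_piMr // -lecR nrmE.
rewrite linearZ nrmZ ger0_norm ?invr_ge0 ?nrm_ge0 //.
by rewrite mulrC ler_pdivrMr.
Qed.

Lemma bounded_byW x K L : bounded_by x K -> K <= L -> bounded_by x L.
Proof. by move=> xK KL u; rewrite (le_trans (xK u)) // ler_wpM2r ?nrm_ge0. Qed.

Lemma bounded_by1 : bounded_by 1 1.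
Proof. by move=> u; rewrite op_oneE mul1r. Qed.

Lemma bounded_byD x y K L :
  bounded_by x K -> bounded_by y L -> bounded_by (x + y) (K + L).
Proof.
by move=> xK yL u; rewrite op_addE mulrDl (le_trans (nrmD _ _)) // lerD.
Qed.

Lemma bounded_byZ r x K : 0 <= r -> bounded_by x K -> bounded_by
  (r%:C *: x) (r * K).
Proof.
by move=> r0 xK u; rewrite op_scaleE nrmZ ger0_norm // -mulrA ler_wpM2l.
Qed.

Lemma bounded_byM x y K L : 0 <= K ->
  bounded_by x K -> bounded_by y L -> bounded_by (x * y) (K * L).
Proof.
move=> K0 xK yL u; rewrite op_mulE (le_trans (xK _)) // -mulrA ler_wpM2l //.
Qed.

Lemma bounded_byX x K k : 0 <= K -> bounded_by x K -> bounded_by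
  (x ^+ k) (K ^+ k).
Proof.
move=> K0 xK; elim: k => [|k IH]; first by rewrite !expr0; exact: bounded_by1.
by rewrite !exprS; exact: bounded_byM.
Qed.

Lemma op_ge0_adjoint_mul z z' : is_adjoint z z' -> op_ge0 (z' * z).
Proof.
move=> zz'; apply: op_ge0P; first exact: (is_adjointM (is_adjointC zz') zz').
by move=> u; rewrite op_mulE (ip_adjoint _ _ (is_adjointC zz')) ip_self sqr_ge0.
Qed.

Lemma scalar_mulE r x : (r%:C *: (1 : B)) * x = r%:C *: x.
Proof. by rewrite -op_scaleAl mul1r. Qed.

End Bounds.

(** * Subalgebras *)

Section Subalgebras.
Context {R : realType} {H : hilbertType R}.
Local Notation B := (bounded_operator H).
Implicit Types (x y z : B) (S A : set B).

Lemma commutant_subalgebra S : subalgebra (commutant S).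
Proof.
split=> [x _|c x y cx cy z Sz|x y cx cy z Sz]; first by rewrite mulr1 mul1r.
  by rewrite mulrDr mulrDl -op_scaleAr -op_scaleAl cx // cy.
by rewrite mulrA cx // -mulrA cy // mulrA.
Qed.

Lemma von_neumann_subalgebra A : von_neumann_algebra A -> subalgebra A.
Proof. by case=> _ <-; exact: commutant_subalgebra. Qed.

Lemma generated_subalgebra S : subalgebra (generated_algebra S).
Proof.
split=> [A [] []//|c x y gx gy A AS|x y gx gy A AS].
- by case: (AS) => [[_ h _] _]; apply: h; [exact: gx|exact: gy].
- by case: (AS) => [[_ _ h] _]; apply: h; [exact: gx|exact: gy].
Qed.

Lemma sub_generated S : S `<=` generated_algebra S.
Proof. by move=> x Sx A [_]; exact. Qed.

Section Closure.
Variable A : set B.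
Hypothesis sA : subalgebra A.

Lemma subalgebra1 : A 1. Proof. by case: sA. Qed.

Lemma subalgebraM x y : A x -> A y -> A (x * y).
Proof. by case: sA => _ _; exact. Qed.

Lemma subalgebraD x y : A x -> A y -> A (x + y).
Proof. by move=> Ax Ay; rewrite -(scale1r x); case: sA => _ h _; exact: h. Qed.

Lemma subalgebra0 : A 0.
Proof.
by rewrite -(addNr 1) -scaleN1r; case: sA => h1 h _; exact: h.
Qed.

Lemma subalgebraZ c x : A x -> A (c *: x).
Proof.
by move=> Ax; rewrite -(addr0 (c *: x)); case: sA => _ h _; apply: h => //;
  exact: subalgebra0.
Qed.

Lemma subalgebraB x y : A x -> A y -> A (x - y).
Proof. by move=> Ax Ay; rewrite -scaleN1r; apply: subalgebraD => //;
  exact: subalgebraZ. Qed.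

Lemma subalgebraX x k : A x -> A (x ^+ k).
Proof.
move=> Ax; elim: k => [|k IH]; first by rewrite expr0; exact: subalgebra1.
by rewrite exprS; exact: subalgebraM.
Qed.

Lemma subalgebra_sum I (s : seq I) (P : pred I) (f : I -> B) :
  (forall i, P i -> A (f i)) -> A (\sum_(i <- s | P i) f i).
Proof.
by move=> Af; elim/big_ind: _ => // [|x y]; [exact: subalgebra0|exact:
  subalgebraD].
Qed.

End Closure.
End Subalgebras.

(** * Trace inequalities *)

Section Trace.
Context {R : realType} {H : hilbertType R}.
Local Notation B := (bounded_operator H).
Implicit Types (x y z a b : B) (r K : R).
Variables (M : set B) (tau : B -> R[i]).
Hypothesis M_vna : von_neumann_algebra M.
Hypothesis tau_nft : normal_faithful_tracial_state M tau.

Let sM : subalgebra M := von_neumann_subalgebra M_vna.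

Let M_adj x : M x -> exists2 y, M y & is_adjoint x y.
Proof. by case: M_vna => h _; exact: h. Qed.

(** The state is real on self-adjoint elements, so nothing is lost there. *)
Definition trace x : R := complex.Re (tau x).
Local Notation t := trace.

Lemma tau0 : tau 0 = 0.
Proof.
have M1 := subalgebra1 sM.
by rewrite -(addNr 1) -scaleN1r (state_linear tau_nft) // mulN1r addNr.
Qed.

Lemma tauZ c x : M x -> tau (c *: x) = c * tau x.
Proof.
move=> Mx; rewrite -(addr0 (c *: x)) (state_linear tau_nft) //;
  last exact: subalgebra0.
by rewrite tau0 addr0.
Qed.

Lemma traceD x y : M x -> M y -> t (x + y) = t x + t y.
Proof.
move=> Mx My; rewrite /t -(scale1r x) (state_linear tau_nft) // mul1r scale1r.
exact: ReD.
Qed.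

Lemma traceZ r x : M x -> t (r%:C *: x) = r * t x.
Proof. by move=> Mx; rewrite /t tauZ // ReZ. Qed.

Lemma traceB x y : M x -> M y -> t (x - y) = t x - t y.
Proof.
move=> Mx My; rewrite -scaleN1r traceD //; last exact: subalgebraZ.
by rewrite -[-1](rmorphN1 (real_complex R)) traceZ // mulN1r.
Qed.

Lemma trace1 : t 1 = 1.
Proof. by rewrite /t (state1 tau_nft). Qed.

Lemma traceC x y : M x -> M y -> t (x * y) = t (y * x).
Proof. by move=> Mx My; rewrite /t (state_tracial tau_nft). Qed.

Lemma trace_ge0 x : M x -> op_ge0 x -> 0 <= t x.
Proof.
by move=> Mx x0; have := state_ge0 tau_nft Mx x0; rewrite lecE => /andP[].
Qed.

Lemma trace_le x y : M x -> M y -> op_le x y -> t x <= t y.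
Proof.
by move=> Mx My xy; rewrite -subr_ge0 -traceB // trace_ge0 //;
  exact: subalgebraB.
Qed.

(** A self-adjoint [x] is a difference of positive elements, [K - (K - x)] for
    a bound [K] of [x], and the state is nonnegative on both. *)
Lemma tau_self_adjoint x : M x -> self_adjoint x -> complex.Im (tau x) = 0.
Proof.
move=> Mx sx; have [K K0 xK] := op_bounded x.
have MK : M (K%:C *: (1 : B)) by apply: subalgebraZ => //; exact: subalgebra1.
have : 0 <= tau (K%:C *: (1 : B) - x).
  apply: (state_ge0 tau_nft); first exact: subalgebraB.
  apply: op_ge0P.
    by apply: is_adjointD; [apply: is_adjointZ|apply: is_adjointN].
  move=> u; rewrite op_subE op_scaleE op_oneE ipBl ipZl ip_self subr_ge0.
  by rewrite (le_trans (ip_CS _ _)) // expr2 mulrA ler_wpM2r ?nrm_ge0.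
rewrite addrC -scaleN1r (state_linear tau_nft) // tauZ ?(state1 tau_nft) //;
  last exact: subalgebra1.
by rewrite lecE => /andP[/eqP + _]; case: (tau x) => c d /=; lra.
Qed.

(** The trace of [x - y] is an imaginary part of the state at [i (x - y)], which
    is self-adjoint. *)
Lemma trace_adjoint x y : M x -> M y -> is_adjoint x y -> t x = t y.
Proof.
move=> Mx My xy; have yx := is_adjointC xy.
have Mxy : M (x - y) by exact: subalgebraB.
apply/eqP; rewrite -subr_eq0 -traceB //; apply/eqP.
have <- : complex.Im (tau ('i *: (x - y))) = t (x - y).
  by rewrite tauZ // /t; case: (tau _) => a b /=; rewrite mul0r mul1r add0r.
apply: tau_self_adjoint; first exact: subalgebraZ.
move=> u v; rewrite !op_scaleE.
have D : inner ((x - y) u) v = - inner u ((x - y) v).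
  by rewrite op_subE linearBl linearBr /= xy yx opprB.
transitivity ('i * inner ((x - y) u) v); first exact: linearZl_LR.
transitivity (Num.conj 'i * inner u ((x - y) v)); last by rewrite linearZ.
rewrite D mulrN -mulNr; congr (_ * _).
by apply/eqP; rewrite eq_complex /= oppr0 !eqxx.
Qed.

(** Cauchy-Schwarz for the trace, in the form given by positivity at [z' z]
    with [z = x' - y]. *)
Lemma trace_AMGM x x' y y' : M x -> M x' -> M y -> M y' ->
  is_adjoint x x' -> is_adjoint y y' ->
  2 * t (x * y) <= t (x * x') + t (y' * y).
Proof.
move=> Mx Mx' My My' ax ay.
have MM u v : M u -> M v -> M (u * v) by exact: subalgebraM.
have MB u v : M u -> M v -> M (u - v) by exact: subalgebraB.
have : 0 <= t ((x - y') * (x' - y)).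
  apply: trace_ge0; first by apply: MM; apply: MB.
  apply: op_ge0_adjoint_mul; apply: is_adjointC.
  by apply: is_adjointD => //; apply: is_adjointN; exact: is_adjointC.
rewrite mulrBl !mulrBr !traceB; try by repeat (first [apply: MB | apply: MM]).
have -> : t (y' * x') = t (x * y).
  by apply: trace_adjoint; [exact: MM|exact: MM|apply: is_adjointM;
    exact: is_adjointC].
lra.
Qed.

Lemma exprM_shift x y k : (x * y) ^+ k * x = x * (y * x) ^+ k.
Proof.
elim: k => [|k IH]; first by rewrite !expr0 mul1r mulr1.
by rewrite exprS -mulrA IH exprS !mulrA.
Qed.

Lemma traceXC x y k : M x -> M y -> t ((x * y) ^+ k) = t ((y * x) ^+ k).
Proof.
move=> Mx My; case: k => [|k]; first by rewrite !expr0.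
have -> : (x * y) ^+ k.+1 = x * ((y * x) ^+ k * y).
  by rewrite exprSr mulrA exprM_shift mulrA.
rewrite traceC // -?mulrA -?exprSr //.
by apply: subalgebraM => //; apply: subalgebraX => //; exact: subalgebraM.
Qed.

(** Weyl's inequality and the Golden-Thompson inequality for powers of two, by a
    common induction on the exponent.

    For the first one, with [K] a power of two, [z^(2K)] is [(z^2)^K]; the induction hypothesis gives
    [z'^2 z^2], which is cyclically equivalent to [P Q] with [P = z' z] and
    [Q = z z'].  The second inequality separates [P] from [Q], and after
    [trace_AMGM] both powers have the same trace.

    For the second one, the first applied to [z = a b] gives [b a a b], which is
    cyclically equivalent to [a^2 b^2], a product of self-adjoint elements with
    half the exponent. *)
Lemma trace_power q :
  (forall z z', M z -> M z' -> is_adjoint z z' ->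
     t (z ^+ (2 ^ q.+1)) <= t ((z' * z) ^+ (2 ^ q))) /\
  (forall a b, M a -> M b -> self_adjoint a -> self_adjoint b ->
     t ((a * b) ^+ (2 ^ q)) <= t (a ^+ (2 ^ q) * b ^+ (2 ^ q))).
Proof.
have MM u v : M u -> M v -> M (u * v) by exact: subalgebraM.
have MX u k : M u -> M (u ^+ k) by exact: subalgebraX.
elim: q => [|q [IHz IHab]].
  split=> [z z' Mz Mz' zz'|a b Ma Mb _ _]; last by rewrite !expr1.
  rewrite expn1 expn0 expr1 expr2.
  have := trace_AMGM Mz Mz' Mz Mz' zz' zz'.
  by rewrite (traceC Mz Mz'); lra.
split=> [z z' Mz Mz' zz'|a b Ma Mb sa sb].
  rewrite expnS exprM.
  apply: le_trans (IHz (z ^+ 2) (z' ^+ 2) _ _ _) _;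
    [exact: MX|exact: MX|exact: is_adjointX|].
  have -> : z' ^+ 2 * z ^+ 2 = z' * (z' * z * z) by rewrite !expr2 !mulrA.
  rewrite traceXC //; last by apply: (MM) => //; apply: MM.
  rewrite -mulrA.
  have sP : self_adjoint (z' * z) by apply: is_adjointM => //;
    exact: is_adjointC.
  have sQ : self_adjoint (z * z') by apply: is_adjointM => //;
    exact: is_adjointC.
  apply: le_trans (IHab _ _ _ _ sP sQ) _; [exact: MM|exact: MM|].
  have Pk : is_adjoint ((z' * z) ^+ (2 ^ q)) ((z' * z) ^+ (2 ^ q)) by
    exact: is_adjointX.
  have Qk : is_adjoint ((z * z') ^+ (2 ^ q)) ((z * z') ^+ (2 ^ q)) by
    exact: is_adjointX.
  have := trace_AMGM _ _ _ _ Pk Qk.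
  rewrite -!exprD addnn -mul2n -expnS (traceXC _ Mz Mz').
  have MP : M ((z' * z) ^+ (2 ^ q)) by exact/MX/MM.
  have MQ : M ((z * z') ^+ (2 ^ q)) by exact/MX/MM.
  by move=> /(_ MP MP MQ MQ); lra.
apply: le_trans (IHz (a * b) (b * a) _ _ _) _;
  [exact: MM|exact: MM|exact: is_adjointM|].
rewrite -mulrA traceXC //; last by apply: (MM) => //; apply: MM.
have -> : a * (a * b) * b = a ^+ 2 * b ^+ 2 by rewrite !expr2 !mulrA.
rewrite expnS !(exprM _ 2); apply: IHab; by [exact: MX|exact: is_adjointX].
Qed.

Lemma trace_bound z K : M z -> bounded_by z K -> t z <= K.
Proof.
move=> Mz zK; have [z' Mz' zz'] := M_adj Mz.
have M1 := subalgebra1 sM.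
have MK : M ((2 * K)%:C *: (1 : B)) by exact: subalgebraZ.
have MD : M (z + z') by exact: subalgebraD.
have : t (z + z') <= t ((2 * K)%:C *: (1 : B)).
  apply: trace_le => //; apply: op_ge0P.
    apply: is_adjointD; first exact: is_adjointZ.
    by apply: is_adjointN; rewrite [X in is_adjoint _ X]addrC;
      apply: is_adjointD => //; exact: is_adjointC.
  move=> u; rewrite op_subE op_scaleE op_oneE op_addE ipBl ipZl ip_self ipDl.
  rewrite (ip_adjoint _ _ (is_adjointC zz')) (ipC u).
  have := ip_CS (z u) u; have := zK u; have := nrm_ge0 u.
  by nra.
by rewrite traceD // -(trace_adjoint Mz Mz' zz') traceZ // trace1; lra.
Qed.

End Trace.

(** * The spectral projections of a self-adjoint operator *)

Lemma le_Rintegral_concentrated d (T : measurableType d) (R : realType)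
  (mu : {measure set T -> \bar R}) (I : set T) (f g : T -> R) :
  measurable I -> mu (~` I) = 0%E ->
  mu.-integrable setT (EFin \o f) -> mu.-integrable setT (EFin \o g) ->
  (forall s, I s -> f s <= g s) ->
  \int[mu]_s f s <= \int[mu]_s g s.
Proof.
move=> mI I0 intf intg fg.
have mIc : measurable (~` I) by exact: measurableC.
have red h : mu.-integrable setT (EFin \o h) ->
    \int[mu]_s h s = \int[mu]_(s in I) h s.
  move=> ih; rewrite /Rintegral (negligible_integral mIc) //.
  by rewrite setTD setCK.
rewrite !red //; apply: le_Rintegral => //.
  by apply: integrableS intf.
by apply: integrableS intg.
Qed.

Section SpectralMeasure.
Context {R : realType} {H : hilbertType R}.
Local Notation B := (bounded_operator H).
Implicit Types (u v w : H) (s t : R) (I J : set (measurableTypeR R)).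
Variables (a : B) (P : set (measurableTypeR R) -> B).
Hypothesis a_sa : self_adjoint a.
Hypothesis sm : spectral_measure a P.

Let P_sa I : measurable I -> self_adjoint (P I).
Proof. by case/(sm_projection sm). Qed.

Let P_idem I : measurable I -> P I * P I = P I.
Proof. by case/(sm_projection sm). Qed.

Lemma ip_spectral I u : measurable I -> ip (P I u) u = nrm (P I u) ^+ 2.
Proof.
by move=> mI; rewrite -ip_self [RHS](ip_adjoint _ _ (P_sa mI)) -op_mulE P_idem
  // [LHS]ipC.
Qed.

Lemma spectral_scalar_measure u :
  exists mu : {measure set (measurableTypeR R) -> \bar R},
    [/\ forall I, measurable I -> mu I = (nrm (P I u) ^+ 2)%:E,
        mu.-integrable setT (fun s : measurableTypeR R => (s : R)%:E) &
        ip (a u) u = \int[mu]_s (s : R)].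
Proof.
have [mu [muE imu au]] := sm_integral sm u.
exists mu; split => //; last by rewrite /ip au.
by move=> I mI; rewrite muE // -ip_spectral.
Qed.


Lemma spectral0 : P set0 = 0.
Proof.
apply: bounded_operatorP => u; have [mu [muE _ _]] := spectral_scalar_measure u.
have := muE set0 measurable0; rewrite measure0 => -[/esym/eqP].
by rewrite sqrf_eq0 => /eqP/nrm_eq0.
Qed.

(** The scalar measure of a vector in the range of [P I] gives no mass to the
    complement of [I]. *)
Lemma spectral_scalar_outside I u : measurable I -> P (~` I) (P I u) = 0.
Proof.
move=> mI; rewrite -op_mulE -(smI sm) ?setICl ?spectral0 //.
exact: measurableC.
Qed.

Let integrable_constant (mu : {measure set (measurableTypeR R) -> \bar R}) t :
  (mu setT < +oo)%E -> mu.-integrable setT (EFin \o cst t).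
Proof.
move=> muT; apply: measurable_bounded_integrable => //.
by exists `|t|; split; [exact: num_real|move=> M tM s _ /=; exact: ltW].
Qed.

Lemma spectral_form_ge I t u : measurable I -> (forall s, I s -> t <= s) ->
  t * nrm (P I u) ^+ 2 <= ip (a (P I u)) (P I u).
Proof.
move=> mI It; have [mu [muE imu ->]] := spectral_scalar_measure (P I u).
have muT : mu setT = (nrm (P I u) ^+ 2)%:E by rewrite muE // (smT sm).
have -> : t * nrm (P I u) ^+ 2 = \int[mu]_(_ in setT) t.
  by rewrite Rintegral_cst // muT.
apply: (le_Rintegral_concentrated mI) => //.
  by rewrite muE ?spectral_scalar_outside ?nrm0 ?expr0n //; exact: measurableC.
by apply: integrable_constant; rewrite muT ltry.
Qed.

Lemma spectral_form_le I t u : measurable I -> (forall s, I s -> s <= t) ->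
  ip (a (P I u)) (P I u) <= t * nrm (P I u) ^+ 2.
Proof.
move=> mI It; have [mu [muE imu ->]] := spectral_scalar_measure (P I u).
have muT : mu setT = (nrm (P I u) ^+ 2)%:E by rewrite muE // (smT sm).
have -> : t * nrm (P I u) ^+ 2 = \int[mu]_(_ in setT) t.
  by rewrite Rintegral_cst // muT.
apply: (le_Rintegral_concentrated mI) => //.
  by rewrite muE ?spectral_scalar_outside ?nrm0 ?expr0n //; exact: measurableC.
by apply: integrable_constant; rewrite muT ltry.
Qed.

(** The scalar measure of [u] is the sum of those of [P I u] and [u - P I u]:
    the cross terms vanish because [P I] commutes with every [P J]. *)
Lemma spectral_form_split I u : measurable I ->
  ip (a u) u = ip (a (P I u)) (P I u) + ip (a (u - P I u)) (u - P I u).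
Proof.
move=> mI.
have [mu [muE imu ->]] := spectral_scalar_measure u.
have [m1 [m1E im1 ->]] := spectral_scalar_measure (P I u).
have [m2 [m2E im2 ->]] := spectral_scalar_measure (u - P I u).
have E J : measurable J -> mu J = measure_add m1 m2 J.
  move=> mJ; rewrite measure_addE muE // m1E // m2E // -EFinD; congr (_%:E).
  have -> : P J u = P J (P I u) + P J (u - P I u).
    by rewrite -linearD addrC subrK.
  have mIJ := measurableI _ _ mI mJ.
  have PIJ : P I (P J (P I u)) = P J (P I u).
    by rewrite -!op_mulE -!(smI sm) // setIAC setIid setIC.
  rewrite -!ip_self ipDl !ipDr.
  suff: ip (P J (P I u)) (P J (u - P I u)) = 0.
    by move=> c; rewrite (ipC (P J (u - _))) c; ring.
  rewrite -(ip_adjoint _ _ (P_sa mJ)) -(op_mulE (P J) (P J)) P_idem // -PIJ.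
  rewrite (ip_adjoint _ _ (P_sa mI)) linearB /= -(op_mulE (P I) (P I)) P_idem
    //.
  by rewrite subrr ip0r.
rewrite /Rintegral.
have -> : (\int[mu]_s (s : R)%:E = \int[measure_add m1 m2]_s (s : R)%:E)%E.
  by apply: eq_measure_integral => J mJ _; exact: E.
rewrite integral_measure_add //.
by rewrite fineD //; exact: integrable_fin_num.
Qed.

(** Polarisation of [spectral_form_split]: the form of [a] has no cross terms
    between the range and the kernel of [P I]. *)
Lemma spectral_offdiag I u v : measurable I ->
  ip (a (P I u)) (v - P I v) = 0.
Proof.
move=> mI.
set x := P I u; set y := v - P I v.
have PP w : P I (P I w) = P I w by rewrite -op_mulE P_idem.
have := spectral_form_split (x + y) mI.
have -> : P I (x + y) = x.
  by rewrite linearD /= /x /y linearB /= !PP subrr addr0.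
have -> : x + y - x = y by rewrite addrAC subrr add0r.
move: x y => x y; have := ip_adjoint y x a_sa.
rewrite !linearD /= !ipDl !ipDr (ipC y).
lra.
Qed.

Lemma spectral_commute I : measurable I -> P I * a = a * P I.
Proof.
move=> mI.
have PaP : P I * a * P I = a * P I.
  apply: bounded_operatorP => u; rewrite !op_mulE; set z := a (P I u).
  suff : z - P I z = 0 by move/eqP; rewrite subr_eq0 => /eqP <-.
  apply/nrm_eq0/eqP; rewrite -sqrf_eq0 -ip_self ipBl spectral_offdiag // sub0r.
  rewrite (ip_adjoint _ _ (P_sa mI)) linearB /= -(op_mulE (P I) (P I)) P_idem
    //.
  by rewrite subrr ip0r oppr0.
rewrite -PaP; apply: bounded_operatorP => u; apply: ipP => v.
by rewrite !op_mulE !(ip_adjoint _ _ (P_sa mI),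
  ip_adjoint _ _ a_sa) -!op_mulE ?mulrA PaP.
Qed.

Lemma spectralC I : measurable I -> P (~` I) = 1 - P I.
Proof.
move=> mI; have mIc := measurableC mI.
have PT : P (~` I) * P I = 0 by rewrite -(smI sm) // setICl spectral0.
suff D : P (~` I) + P I = 1 by rewrite -D addrK.
apply: bounded_operatorP => u; apply/eqP; rewrite -subr_eq0; apply/eqP.
set w := _ - _.
have [mu [muE _ _]] := spectral_scalar_measure w.
have Pw0 : P I w = 0.
  rewrite /w op_addE linearB linearD /= -!op_mulE -(smI sm) // setICr spectral0.
  by rewrite P_idem // add0r subrr.
have Pcw0 : P (~` I) w = 0.
  rewrite /w op_addE linearB linearD /= -!op_mulE -(smI sm) // setIid.
  by rewrite PT addr0 subrr.
apply/nrm_eq0/eqP; rewrite -sqrf_eq0; apply/eqP.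
have : mu setT = 0%E.
  rewrite -(setvU I); transitivity (mu (~` I) + mu I)%E.
    by apply: measureU => //; rewrite setICl.
  by rewrite !muE // Pw0 Pcw0 nrm0 expr0n adde0.
by rewrite muE // (smT sm) => -[].
Qed.

(** Strong convergence of the projections of [(-oo,s]] to that of [(-oo,t)] as
    [s] increases to [t], from continuity of the scalar measure of [u] along
    increasing unions. *)
Lemma spectral_left_limit t u (e : R) : 0 < e -> exists2 s, s < t &
  nrm (P [set` `]-oo, t[%R] u - P [set` `]-oo, s]%R] u) <= e.
Proof.
move=> e0.
pose F n : set (measurableTypeR R) := [set` `]-oo, (t - n.+1%:R^-1)%R]].
have mF n : measurable (F n) by exact: measurable_itv.
have FE : \bigcup_n F n = [set` `]-oo, t[%R].
  apply/seteqP; split=> [s [n _]|s]; rewrite /F /= !in_itv /=.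
    by move=> /le_lt_trans; apply; rewrite ltrBlDr ltrDl invr_gt0.
  move=> /ltr_add_invr[n sn]; exists n => //=.
  by rewrite in_itv /= lerBrDr ltW.
have mI : measurable ([set` `]-oo, t[%R] : set (measurableTypeR R)) by
  exact: measurable_itv.
have [mu [muE _ _]] := spectral_scalar_measure u.
have : mu \o F @ \oo --> mu [set` `]-oo, t[%R].
  rewrite -FE; apply: nondecreasing_cvg_mu => //; first by rewrite FE.
  move=> m n mn; apply/subsetPset => s; rewrite /F /= !in_itv /= => /le_trans;
    apply.
  by rewrite lerB // lef_pV2 ?posrE // ler_nat.
rewrite muE //.
have -> : mu \o F = (fun n => (nrm (P (F n) u) ^+ 2)%:E).
  by apply/funext => n /=; rewrite muE.
move=> /fine_cvgP[_ /cvgrPdist_le/(_ (e ^+ 2))]; rewrite exprn_gt0 // =>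
  /(_ isT).
case=> n _ /(_ n (leqnn _)) /=.
move=> h.
pose I : set (measurableTypeR R) := [set` `]-oo, t[%R].
pose J := F n; have mJ : measurable J := mF n.
rewrite -/I -/J in h mI *.
exists (t - n.+1%:R^-1); first by rewrite ltrBlDr ltrDl invr_gt0.
rewrite -/I -/(F n) -/J -(ler_pXn2r (n := 2)) ?nnegrE ?nrm_ge0 ?(ltW e0) //.
have IJ : I `&` J = J.
  rewrite setIC; apply/setIidPl => s; rewrite /J /I /F /= !in_itv /= =>
    /le_lt_trans; apply.
  by rewrite ltrBlDr ltrDl invr_gt0.
have -> : nrm (P I u - P J u) ^+ 2 = nrm (P I u) ^+ 2 - nrm (P J u) ^+ 2.
  rewrite -!ip_self !ipBl !ipBr.
  have E : ip (P I u) (P J u) = ip (P J u) (P J u).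
    rewrite (ip_adjoint _ _ (P_sa mI)) -(op_mulE (P I)) -(smI sm) // IJ.
    by rewrite [RHS](ip_adjoint _ _ (P_sa mJ)) -(op_mulE (P J)) P_idem.
  by rewrite (ipC (P J u) (P I u)) E subrr subr0.
exact: le_trans (ler_norm _) h.
Qed.

End SpectralMeasure.

(** * Commutation with the commutant *)

Section FormBounds.
Context {R : realType} {H : hilbertType R}.
Local Notation B := (bounded_operator H).
Implicit Types (x y p q : B) (u v w : H) (c d : R).

Lemma commute_pow x q k u : q * x = x * q -> (x ^+ k) (q u) = q ((x ^+ k) u).
Proof.
move=> qx; suff E : q * x ^+ k = x ^+ k * q by rewrite -!op_mulE E.
exact: commrX.
Qed.

(** For a positive [x], the form inequality [x <= d] on the range of [p] bounds
    the norm of [x] there; this is Cauchy-Schwarz for the semi-inner product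
    [ip (x v) w]. *)
Lemma form_contract x p d k u : self_adjoint x -> (forall v, 0 <= ip (x v) v) ->
  p * x = x * p -> 0 < d ->
  (forall v, ip (x (p v)) (p v) <= d * nrm (p v) ^+ 2) ->
  nrm ((x ^+ k) (p u)) <= d ^+ k * nrm (p u).
Proof.
move=> sx x0 px d0 xd.
have step v : nrm (x (p v)) <= d * nrm (p v).
  set w := x (p v).
  have pw : p (x v) = w by rewrite /w -!op_mulE px.
  (* Positivity of the form of x at d p v - w gives |w| <= d |p v|. *)
  have := x0 (d%:C *: p v - w); have := xd (x v); rewrite pw => ww.
  rewrite linearB linearZ /= -/w !(ipBl, ipBr, ipZl, ipZr) ip_self.
  rewrite (ip_adjoint w (p v) sx) -/w ip_self => h.
  have := xd v; rewrite -/w => h1.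
  rewrite -(ler_pXn2r (n := 2)) ?nnegrE ?nrm_ge0 ?mulr_ge0 ?nrm_ge0 ?(ltW d0)
    //.
  rewrite exprMn -subr_ge0 -(pmulr_rge0 _ d0).
  apply: le_trans h _.
  have : d * (d * ip w (p v)) <= d * (d * (d * nrm (p v) ^+ 2)).
    by rewrite !(ler_pM2l d0).
  by move: ww; lra.
elim: k => [|k IH]; first by rewrite !expr0 mul1r op_oneE.
rewrite !exprS op_mulE commute_pow // (le_trans (step _)) //.
by rewrite -commute_pow // -mulrA (ler_pM2l d0).
Qed.

Lemma form_expand x q c k u : q * x = x * q -> 0 <= c ->
  (forall v, c * nrm (q v) ^+ 2 <= ip (x (q v)) (q v)) ->
  c ^+ k * nrm (q u) <= nrm ((x ^+ k) (q u)).
Proof.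
move=> qx c0 xc.
have step v : c * nrm (q v) <= nrm (x (q v)).
  have := nrm_ge0 (q v); rewrite le_eqVlt => /predU1P[<-|q0]; first by
    rewrite mulr0 nrm_ge0.
  rewrite -(ler_pM2r q0) -mulrA -expr2.
  exact: le_trans (xc _) (ip_CS _ _).
elim: k => [|k IH]; first by rewrite !expr0 mul1r op_oneE.
rewrite !exprS op_mulE commute_pow // (le_trans _ (step _)) //.
by rewrite -commute_pow // -mulrA ler_wpM2l.
Qed.

Lemma geometric_gap (A C c d : R) : 0 < d -> d < c ->
  (forall k, c ^+ k * A <= C * d ^+ k) -> A <= 0.
Proof.
move=> d0 dc h; have c0 := lt_trans d0 dc.
have cv : (fun k => C * (d / c) ^+ k) @ \oo --> C * 0.
  apply: cvgMr; apply: cvg_expr.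
  by rewrite ger0_norm ?divr_ge0 ?ltW // ltr_pdivrMr // mul1r.
rewrite -(mulr0 C) -(cvg_lim _ cv) //; apply: limr_ge; first exact: cvgP cv.
near=> k; rewrite exprMn exprVn mulrA ler_pdivlMr ?exprn_gt0 //.
by rewrite mulrC.
Unshelve. all: by end_near. Qed.

(** An operator [q y p] that intertwines [x] with itself maps vectors on which
    the powers of [x] grow at most like [d^k] to vectors on which they grow at
    least like [c^k]; as [d < c], the image vanishes. *)
Lemma intertwiner_eq0 x y p q c d :
  self_adjoint x -> (forall v, 0 <= ip (x v) v) ->
  p * x = x * p -> q * x = x * q -> y * x = x * y -> 0 < d -> d < c ->
  (forall v, ip (x (p v)) (p v) <= d * nrm (p v) ^+ 2) ->
  (forall v, c * nrm (q v) ^+ 2 <= ip (x (q v)) (q v)) ->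
  q * y * p = 0.
Proof.
move=> sx x0 px qx yx d0 dc xd xc; apply: bounded_operatorP => u.
rewrite !op_mulE; apply/nrm_eq0/eqP; rewrite eq_le nrm_ge0 andbT.
have [K K0 qyK] := op_bounded (q * y).
have c0 : 0 <= c by rewrite ltW // (lt_trans d0).
apply: (@geometric_gap _ (K * nrm (p u)) _ _ d0 dc) => k.
apply: le_trans (form_expand k _ qx c0 xc) _.
rewrite commute_pow // (commute_pow k (p u)) // -op_mulE (le_trans (qyK _)) //.
rewrite -mulrA ler_wpM2l // mulrC; exact: form_contract.
Qed.

End FormBounds.

Section SpectralCommutant.
Context {R : realType} {H : hilbertType R}.
Local Notation B := (bounded_operator H).
Variables (a : B) (P : set (measurableTypeR R) -> B).
Hypothesis a_sa : self_adjoint a.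
Hypothesis sm : spectral_measure a P.

Let up t : set (measurableTypeR R) := [set` `[t, +oo[%R].
Let dn s : set (measurableTypeR R) := [set` `]-oo, s]%R].

Let m_up t : measurable (up t). Proof. exact: measurable_itv. Qed.
Let m_dn s : measurable (dn s). Proof. exact: measurable_itv. Qed.

Let up_ge t u : t * nrm (P (up t) u) ^+ 2 <= ip (a (P (up t) u)) (P (up t) u).
Proof. by apply: (spectral_form_ge sm) => // s;
  rewrite /up /= in_itv /= andbT. Qed.

Let dn_le t u : ip (a (P (dn t) u)) (P (dn t) u) <= t * nrm (P (dn t) u) ^+ 2.
Proof. by apply: (spectral_form_le sm) => // s; rewrite /dn /= in_itv. Qed.

(** [intertwiner_eq0] with the positive operators [K - a] and [K + a] shows
    that [y] has no component between the ranges of the projections of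
    [(-oo,s]] and [[t,oo)], in either direction, for [s < t].  Letting [s]
    increase to [t] covers the complement of [[t,oo)].  Both directions have to
    be treated, since [y] need not be self-adjoint. *)
Lemma spectral_commutant y t : y * a = a * y -> y * P (up t) = P (up t) * y.
Proof.
move=> ya.
have [C C0 aC] := op_bounded a.
have aform u : `|ip (a u) u| <= C * nrm u ^+ 2.
  have h : nrm (a u) * nrm u <= C * nrm u ^+ 2.
    by rewrite expr2 mulrA ler_wpM2r ?nrm_ge0.
  rewrite ler_norml (le_trans _ (ip_CSn _ _)) ?lerN2 //=.
  exact: le_trans (ip_CS _ _) h.
have sep s : s < t ->
    P (dn s) * y * P (up t) = 0 /\ P (up t) * y * P (dn s) = 0.
  (* K exceeds |s| and |t|, which makes K - t and K + s positive. *)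
  move=> st; pose K := C + `|s| + `|t| + 1.
  have [sK tK] : `|s| < K /\ `|t| < K.
    by rewrite /K; have := normr_ge0 s; have := normr_ge0 t; split; lra.
  have CK : C <= K by rewrite /K; have := normr_ge0 s; have := normr_ge0 t; lra.
  clearbody K; have kc (z : B) : z * (K%:C *: (1 : B)) = (K%:C *: (1 : B)) * z.
    by rewrite -op_scaleAr mulr1 scalar_mulE.
  have cp I : measurable I -> P I * a = a * P I by exact: spectral_commute.
  have ipK (u : H) : ip ((K%:C *: (1 : B)) u) u = K * nrm u ^+ 2.
    by rewrite op_scaleE op_oneE ipZl ip_self.
  have CKu (u : H) : C * nrm u ^+ 2 <= K * nrm u ^+ 2 by
    rewrite ler_wpM2r ?sqr_ge0.
  move: sK tK; rewrite !ltr_norml => /andP[sK1 sK2] /andP[tK1 tK2].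
  split.
    apply: (@intertwiner_eq0 _ _ (K%:C *: (1 : B) - a) y _ _ (K - s) (K - t)).
    - by apply: is_adjointD; [apply: is_adjointZ|apply: is_adjointN].
    - move=> u; rewrite op_subE ipBl ipK subr_ge0 (le_trans _ (CKu u)) //.
      exact: le_trans (ler_norm _) (aform u).
    - by rewrite mulrBr mulrBl kc cp.
    - by rewrite mulrBr mulrBl kc cp.
    - by rewrite mulrBr mulrBl kc ya.
    - by rewrite subr_gt0.
    - by rewrite ltrD2l ltrN2.
    - by move=> u; rewrite op_subE ipBl ipK mulrBl lerD2l lerN2.
    - by move=> u; rewrite op_subE ipBl ipK mulrBl lerD2l lerN2.
  apply: (@intertwiner_eq0 _ _ (K%:C *: (1 : B) + a) y _ _ (K + t) (K + s)).
  - by apply: is_adjointD => //; apply: is_adjointZ.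
  - move=> u; rewrite op_addE ipDl ipK -lerBlDr sub0r (le_trans _ (CKu u)) //.
    by have := aform u; rewrite ler_norml => /andP[]; rewrite lerNl.
  - by rewrite mulrDr mulrDl kc cp.
  - by rewrite mulrDr mulrDl kc cp.
  - by rewrite mulrDr mulrDl kc ya.
  - by rewrite -ltrBlDl sub0r.
  - by rewrite ltrD2l.
  - by move=> u; rewrite op_addE ipDl ipK mulrDl lerD2l.
  - by move=> u; rewrite op_addE ipDl ipK mulrDl lerD2l.
have upC : P [set` `]-oo, t[%R] = 1 - P (up t).
  rewrite -(spectralC sm) //; congr P; apply/seteqP; split=> s;
    rewrite /up /= !in_itv /= andbT.
    by rewrite ltNge => /negP.
  by move/negP; rewrite -ltNge.
have h1 : (1 - P (up t)) * y * P (up t) = 0.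
  apply: bounded_operatorP => u; rewrite !op_mulE; apply/nrm_eq0/eqP.
  rewrite eq_le nrm_ge0 andbT; apply/ler_addgt0Pl => e e0; rewrite addr0 -upC.
  have [s st] := spectral_left_limit sm t (y (P (up t) u)) e0.
  by have [E _] := sep _ st; rewrite -!op_mulE E subr0.
have h2 : P (up t) * y * (1 - P (up t)) = 0.
  apply: bounded_operatorP => u; rewrite op_mulE; apply/nrm_eq0/eqP.
  have [K K0 yK] := op_bounded (P (up t) * y).
  rewrite eq_le nrm_ge0 andbT; apply/ler_addgt0Pl => e e0; rewrite addr0 -upC.
  have K1 : 0 < K + 1 by lra.
  have [s st h] := spectral_left_limit sm t u (divr_gt0 e0 K1).
  have [_ E] := sep _ st.
  have := congr1 (fun x : B => x u) E; rewrite op_mulE => E0.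
  rewrite -[X in nrm X]subr0 -[X in _ - X]E0 -linearB (le_trans (yK _)) //.
  apply: (@le_trans _ _ ((K + 1) * (e / (K + 1)))).
    by apply: ler_pM => //; [exact: nrm_ge0|lra].
  by rewrite mulrC divfK ?gt_eqF.
move: h1 h2; rewrite mulrBr mulr1 mulrBl mul1r mulrBl.
by move=> /subr0_eq e1 /subr0_eq e2; rewrite e1 -e2.
Qed.

(** On the range of the projection, [1 + h a >= c]; elsewhere an even power is
    nonnegative. *)
Lemma spectral_power_ge t c (h : R) k : 0 <= h -> c = 1 + h * t -> 0 <= c ->
  op_le ((c ^+ (2 * k))%:C *: P (up t)) ((1 + h%:C *: a) ^+ (2 * k)).
Proof.
move=> h0 cE c0; set y := 1 + h%:C *: a.
have sy : self_adjoint y by apply: is_adjointD;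
  [exact: is_adjoint1|exact: is_adjointZ].
have [sP PP] := sm_projection sm (m_up t).
apply: op_ge0P.
  by apply: is_adjointD; [exact: is_adjointX|apply: is_adjointN;
    exact: is_adjointZ].
move=> u; rewrite op_subE op_scaleE ipBl ipZl subr_ge0 (ip_spectral sm) //.
rewrite mul2n -addnn !exprD -expr2 op_mulE.
have syk : self_adjoint (y ^+ k) by exact: is_adjointX.
rewrite (ip_adjoint _ _ syk) ip_self -exprMn.
rewrite ler_pXn2r ?nnegrE ?mulr_ge0 ?exprn_ge0 ?nrm_ge0 //.
have yP : P (up t) * y = y * P (up t).
  by rewrite mulrDr mulrDl mulr1 mul1r -op_scaleAr -op_scaleAl
    (spectral_commute a_sa sm).
apply: (@le_trans _ _ (nrm ((y ^+ k) (P (up t) u)))).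
  apply: form_expand => // v.
  by rewrite cE op_addE op_oneE ipDl ip_self mulrDl mul1r lerD2l op_scaleE ipZl
    -mulrA ler_wpM2l.
rewrite commute_pow //; move: ((y ^+ k) u) => w.
have := nrm_ge0 (P (up t) w); rewrite le_eqVlt => /predU1P[<-|q0];
  first exact: nrm_ge0.
by rewrite -(ler_pM2l q0) -expr2 -(ip_spectral sm) // ip_CS.
Qed.

End SpectralCommutant.

(** * Powers of operators near the identity *)

Section PowerEstimates.
Context {R : realType} {H : hilbertType R}.
Local Notation B := (bounded_operator H).
Implicit Types (x y b S : B) (u : H) (h K L m lambda : R).

Lemma pow_le_expR h K k : 0 <= h -> 0 <= K ->
  (1 + h * K) ^+ k <= expR (k%:R * (h * K)).
Proof.
move=> h0 K0; rewrite expRM_natl.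
by rewrite lerXn2r ?nnegrE ?expR_ge0 ?addr_ge0 ?mulr_ge0 // expR_ge1Dx.
Qed.

(** From [e^(y - y^2) <= 1 + y] with [y = x / k]. *)
Lemma expR_le_pow (x : R) k : 0 <= x -> (0 < k)%N ->
  expR x * (1 - x ^+ 2 / k%:R) <= (1 + x / k%:R) ^+ k.
Proof.
move=> x0 k0; have k0' : (0 : R) < k%:R by rewrite ltr0n.
set y := x / k%:R; have y0 : 0 <= y by rewrite divr_ge0 // ltW.
have y1 : 0 < 1 + y by lra.
have step : expR (y - y ^+ 2) <= 1 + y.
  have : 1 - y / (1 + y) <= expR (- (y / (1 + y))) by exact: expR_ge1Dx.
  have -> : 1 - y / (1 + y) = (1 + y)^-1 by field; rewrite gt_eqF.
  rewrite expRN lef_pV2 ?posrE ?expR_gt0 // => /(le_trans _); apply.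
  rewrite ler_expR ler_pdivlMr //.
  have -> : (y - y ^+ 2) * (1 + y) = y - y * y ^+ 2 by ring.
  by rewrite gerBl mulr_ge0 ?sqr_ge0.
have : expR (y - y ^+ 2) ^+ k <= (1 + y) ^+ k.
  by rewrite ler_pXn2r ?nnegrE ?expR_ge0 ?(ltW y1).
apply: le_trans; rewrite -expRM_natl.
have -> : k%:R * (y - y ^+ 2) = x + - (x ^+ 2 / k%:R).
  by rewrite /y; field; rewrite gt_eqF.
by rewrite expRD ler_pM2l ?expR_gt0 // expR_ge1Dx.
Qed.

(** Telescoping, with [k] terms of size at most [q^k d]. *)
Lemma bounded_power_diff x y (q d : R) k : 1 <= q -> 0 <= d ->
  bounded_by x q -> bounded_by y q -> bounded_by (x - y) d ->
  bounded_by (x ^+ k - y ^+ k) (k%:R * (q ^+ k * d)).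
Proof.
move=> q1 d0 xq yq xyd; have q0 : 0 <= q by lra.
elim: k => [|k IH u]; first by move=> u; rewrite !expr0 subrr mul0r mul0r nrm0.
have -> : x ^+ k.+1 - y ^+ k.+1 = x * (x ^+ k - y ^+ k) + (x - y) * y ^+ k.
  by rewrite !exprS mulrBr mulrBl addrA subrK.
have := bounded_byD (bounded_byM q0 xq IH) (bounded_byM d0 xyd (bounded_byX k
  q0 yq)).
move=> /(_ u)/le_trans; apply; rewrite ler_wpM2r ?nrm_ge0 //.
rewrite exprS -natr1; have : 0 <= q ^+ k * d by rewrite mulr_ge0 ?exprn_ge0.
nra.
Qed.

(** [1 + h (S + b)] and [(1 + h S) (1 + h b)] differ by [h^2 S b]; with
    [h = lambda / k] the bound is of order [1 / k]. *)
Lemma power_product_diff S b h K L k : 0 <= h -> 0 <= K -> 0 <= L ->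
  bounded_by S K -> bounded_by b L ->
  bounded_by
    ((1 + h%:C *: (S + b)) ^+ k - ((1 + h%:C *: S) * (1 + h%:C *: b)) ^+ k)
    (k%:R * (expR (k%:R * (h * (K + L))) * (h ^+ 2 * (K * L)))).
Proof.
move=> h0 K0 L0 SK bL.
have hK : 0 <= h * K by rewrite mulr_ge0.
have hL : 0 <= h * L by rewrite mulr_ge0.
have hKL : 0 <= h * K * (h * L) by rewrite mulr_ge0.
have d0 : 0 <= h ^+ 2 * (K * L) by rewrite !mulr_ge0 // sqr_ge0.
pose q := (1 + h * K) * (1 + h * L).
have qE : q = 1 + h * K + h * L + h * K * (h * L) by rewrite /q; ring.
apply: (@bounded_byW _ _ _ (k%:R * (q ^+ k * (h ^+ 2 * (K * L))))); last first.
  rewrite ler_wpM2l // ler_wpM2r // exprMn.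
  rewrite mulrDr mulrDr expRD ler_pM ?exprn_ge0 ?pow_le_expR //; lra.
apply: bounded_power_diff => //.
- by rewrite qE; lra.
- apply: (@bounded_byW _ _ _ (1 + h * (K + L))); last by rewrite qE; lra.
  apply: bounded_byD; first exact: bounded_by1.
  by apply: bounded_byZ => //; exact: bounded_byD.
- apply: bounded_byM; first by lra.
    by apply: bounded_byD; [exact: bounded_by1|exact: bounded_byZ].
  by apply: bounded_byD; [exact: bounded_by1|exact: bounded_byZ].
have -> : 1 + h%:C *: (S + b) - (1 + h%:C *: S) * (1 + h%:C *: b) =
          - ((h ^+ 2)%:C *: (S * b)).
  rewrite mulrDr mulr1 mulrDl mul1r -op_scaleAl -op_scaleAr scalerA -rmorphM
    -expr2.
  by rewrite scalerDr !addrA opprD addrA subrr sub0r.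
move=> u; have := bounded_byZ (sqr_ge0 h) (bounded_byM K0 SK bL).
move=> /(_ u); rewrite -nrmN; exact.
Qed.

(** The expansion of [(1 + h b)^k - 1] has nonnegative coefficients and no
    constant term, so its norm at [u] is controlled by the scalar case [b = m]
    together with one factor [b u].  Multiplying by [m] avoids a division. *)
Lemma power_near_one b h m k u : 0 <= h -> 0 <= m -> bounded_by b m ->
  m * nrm (((1 + h%:C *: b) ^+ k) u - u) <= ((1 + h * m) ^+ k - 1) * nrm (b u).
Proof.
move=> h0 m0 bm; set y := 1 + _.
have yb : b * y = y * b.
  by rewrite /y mulrDr mulrDl mulr1 mul1r -op_scaleAr -op_scaleAl.
have yB : bounded_by y (1 + h * m).
  by apply: bounded_byD; [exact: bounded_by1|exact: bounded_byZ].
have hm : 0 <= h * m by rewrite mulr_ge0.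
elim: k => [|k IH]; first by rewrite !expr0 op_oneE !subrr nrm0 mulr0 mul0r.
have -> : (y ^+ k.+1) u - u = ((y ^+ k) u - u) + h%:C *: (y ^+ k) (b u).
  rewrite commute_pow // exprS op_mulE /y op_addE op_oneE op_scaleE.
  by rewrite addrAC.
have := bounded_byX k _ yB (b u); move=> /(_ _)-/(_ ltac:(lra)) h1.
have : m * nrm ((y ^+ k) u - u + h%:C *: (y ^+ k) (b u)) <=
   m * (nrm ((y ^+ k) u - u) + h * nrm ((y ^+ k) (b u))).
  by rewrite ler_wpM2l // (le_trans (nrmD _ _)) // lerD2l nrmZ ger0_norm.
have : h * m * nrm ((y ^+ k) (b u)) <= h * m * ((1 + h * m) ^+ k * nrm (b u)).
  by rewrite ler_wpM2l.
rewrite exprS; move: IH.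
suff arith (A1 A2 A3 A4 A5 : R) : m * A4 <= (A5 - 1) * A3 ->
    h * m * A2 <= h * m * (A5 * A3) -> m * A1 <= m * (A4 + h * A2) ->
    m * A1 <= ((1 + h * m) * A5 - 1) * A3 by exact: arith.
lra.
Qed.

(** Likewise after removal of the linear term: all remaining monomials contain
    [b] twice, and each is at most its scalar analogue times [b^2 / m^2]. *)
Lemma power_second_order b h m k u : 0 <= h -> 0 <= m ->
  self_adjoint b -> bounded_by b m ->
  m ^+ 2 * ip (((1 + h%:C *: b) ^+ k) u) u <=
    m ^+ 2 * (nrm u ^+ 2 + k%:R * h * ip (b u) u) +
    ((1 + h * m) ^+ k - 1 - k%:R * (h * m)) * nrm (b u) ^+ 2.
Proof.
move=> h0 m0 sb bm.
elim: k => [|k IH]; first by rewrite !expr0 op_oneE ip_self !mul0r subr0 subrr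
  addr0 mul0r addr0.
have := power_near_one k u h0 m0 bm.
move: IH; set y := 1 + _; move=> IH near1.
have -> : ip ((y ^+ k.+1) u) u = ip ((y ^+ k) u) u + h * (ip (b u) u + ip ((y
  ^+ k) u - u) (b u)).
  rewrite exprS op_mulE {1}/y op_addE op_oneE op_scaleE ipDl ipZl.
  rewrite (ip_adjoint _ _ sb) ipBl (ipC (b u) u).
  ring.
have : h * m * (m * ip ((y ^+ k) u - u) (b u)) <=
       h * m * (((1 + h * m) ^+ k - 1) * nrm (b u) ^+ 2).
  rewrite ler_wpM2l ?mulr_ge0 //.
  apply: (@le_trans _ _ (m * (nrm ((y ^+ k) u - u) * nrm (b u)))).
    by rewrite ler_wpM2l // ip_CS.
  have -> : ((1 + h * m) ^+ k - 1) * nrm (b u) ^+ 2 =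
            ((1 + h * m) ^+ k - 1) * nrm (b u) * nrm (b u) by
              rewrite expr2 mulrA.
  by rewrite mulrA ler_wpM2r ?nrm_ge0.
rewrite (exprS (1 + h * m)) -natr1; move: IH.
suff arith (A1 A2 A3 A4 A5 A6 K : R) :
    m ^+ 2 * A3 <= m ^+ 2 * (A5 + K * h * A2) + (A6 - 1 - K * (h * m)) * A4 ->
    h * m * (m * A1) <= h * m * ((A6 - 1) * A4) ->
    m ^+ 2 * (A3 + h * (A2 + A1)) <= m ^+ 2 * (A5 + (K + 1) * h * A2) +
      ((1 + h * m) * A6 - 1 - (K + 1) * (h * m)) * A4 by exact: arith.
lra.
Qed.

(** The operator form of [e^(lambda s) <= 1 + lambda s + c s^2] for [|s| <= m]:
    [(e^x - 1 - x) / x^2] is increasing. *)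
Lemma power_le_quadratic b h m k lambda : 0 <= h -> 0 < m ->
  k%:R * h = lambda -> self_adjoint b -> bounded_by b m ->
  op_le ((1 + h%:C *: b) ^+ k)
    (1 + lambda%:C *: b +
     ((expR (lambda * m) - 1 - lambda * m) / m ^+ 2)%:C *: b ^+ 2).
Proof.
move=> h0 m0 kh sb bm.
set g := (X in X%:C *: b ^+ 2); apply: op_ge0P.
  apply: is_adjointD; last first.
    apply: is_adjointN; apply: is_adjointX; apply: is_adjointD;
      first exact: is_adjoint1.
    exact: is_adjointZ.
  by apply: is_adjointD; [apply: is_adjointD;
    [exact: is_adjoint1|exact: is_adjointZ]|
    apply: is_adjointZ; exact: is_adjointX].
move=> u; rewrite op_subE !op_addE op_oneE !op_scaleE ipBl !ipDl !ipZl ip_self.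
rewrite expr2 op_mulE (ip_adjoint (b u) u sb) ip_self subr_ge0.
rewrite -(ler_pM2l (exprn_gt0 2 m0)).
apply: le_trans (power_second_order k u h0 (ltW m0) sb bm) _.
rewrite [leRHS]mulrDr kh lerD2l (mulrA (m ^+ 2)) ler_wpM2r ?sqr_ge0 //.
rewrite /g [leRHS]mulrCA mulfV ?mulr1 ?expf_neq0 ?gt_eqF // -kh -!mulrA.
by rewrite !lerD2r pow_le_expR // ltW.
Qed.

End PowerEstimates.

(** * One step: removing an independent summand *)

Section ConditionalExpectation.
Context {R : realType} {H : hilbertType R}.
Local Notation B := (bounded_operator H).
Implicit Types (x y w b : B) (c h : R).
Variables (M N : set B) (tau : B -> R[i]) (E : B -> B).
Hypothesis M_vna : von_neumann_algebra M.
Hypothesis tau_nft : normal_faithful_tracial_state M tau.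
Hypothesis N_vna : von_neumann_algebra N.
Hypothesis N_sub_M : N `<=` M.
Hypothesis E_ce : conditional_expectation M N tau E.

Local Notation t := (trace tau).
Let sM : subalgebra M := von_neumann_subalgebra M_vna.

Let EM x : M x -> M (E x).
Proof. by move=> Mx; apply/N_sub_M/(ce_sub E_ce). Qed.

Lemma ceD x y : M x -> M y -> E (x + y) = E x + E y.
Proof.
move=> Mx My; rewrite -[x in LHS]scale1r (ce_linear E_ce) //.
by rewrite scale1r.
Qed.

Lemma ceZ (c : R[i]) x : M x -> E (c *: x) = c *: E x.
Proof.
move=> Mx; have M0 := subalgebra0 sM.
have E0 : E 0 = 0 by apply: (addrI (E 0)); rewrite -ceD // !addr0.
by rewrite -[c *: x]addr0 (ce_linear E_ce) // E0 addr0.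
Qed.

Lemma ce_le x y : M x -> M y -> op_le x y -> op_le (E x) (E y).
Proof.
move=> Mx My xy; rewrite /op_le.
have -> : E y - E x = E (y - x).
  have Mnx : M (-1 *: x) by exact: subalgebraZ.
  by rewrite -[- E x]scaleN1r -ceZ // -ceD // scaleN1r.
by apply: (ce_ge0 E_ce) => //; exact: subalgebraB.
Qed.

(** Independence and the module property give [E (x y) = E x E y = E (E x y)],
    and [E] preserves the trace. *)
Lemma trace_mul_ce x y : M x -> M y -> E (x * y) = E x * E y ->
  t (x * y) = t (E x * y).
Proof.
move=> Mx My Exy; have Mxy : M (x * y) by exact: subalgebraM.
have MExy : M (E x * y) by apply: subalgebraM => //; exact: EM.
rewrite /trace -(ce_preserving E_ce Mxy) -(ce_preserving E_ce MExy) Exy.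
have := ce_bimodule E_ce (ce_sub E_ce Mx) My (subalgebra1
  (von_neumann_subalgebra N_vna)).
by rewrite !mulr1 => ->.
Qed.

(** By cyclicity, [x w^2] has the same trace as [w x w <= c w^2]. *)
Lemma trace_mul_le x w c : M x -> M w -> self_adjoint w ->
  op_le x (c%:C *: (1 : B)) -> t (x * w ^+ 2) <= c * t (w ^+ 2).
Proof.
move=> Mx Mw sw xc; have Mw2 : M (w ^+ 2) by exact: subalgebraX.
have M1 := subalgebra1 sM.
have Mxw : M (x * w) by exact: subalgebraM.
have Mwxw : M (w * (x * w)) by exact: subalgebraM.
have McW : M (c%:C *: w ^+ 2) by exact: subalgebraZ.
have := trace_ge0 tau_nft (subalgebraB sM McW Mwxw).
rewrite (traceB M_vna tau_nft) // (traceZ M_vna tau_nft) //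
  subr_ge0 (traceC tau_nft) // -mulrA => h.
apply: le_trans (h _); first by rewrite expr2.
have -> : c%:C *: w ^+ 2 - w * (x * w) = w * (c%:C *: (1 : B) - x) * w.
  by rewrite mulrBr mulrBl -op_scaleAr mulr1 -op_scaleAl expr2 mulrA.
move=> u; rewrite !op_mulE.
by rewrite (sw _ u); exact: xc.
Qed.

(** The factor [w^2] stands for the Euler approximation of [e^(lambda S)]: an
    even power of a self-adjoint element, hence positive. *)
Lemma trace_independent_le b w c h k lambda sigma m :
  M b -> self_adjoint b -> bounded_by b m -> 0 < m -> 0 <= h ->
  k%:R * h = lambda ->
  E b = 0 -> op_le (E (b ^+ 2)) ((sigma ^+ 2)%:C *: (1 : B)) ->
  M w -> self_adjoint w ->
  E ((1 + h%:C *: b) ^+ k * w ^+ 2) = E ((1 + h%:C *: b) ^+ k) * E (w ^+ 2) ->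
  c = (expR (lambda * m) - 1 - lambda * m) / m ^+ 2 ->
  t ((1 + h%:C *: b) ^+ k * w ^+ 2) <= expR (c * sigma ^+ 2) * t (w ^+ 2).
Proof.
move=> Mb sb bm m0 h0 kh Eb0 Eb2 Mw sw Ebw cE.
have M1 := subalgebra1 sM.
have c0 : 0 <= c.
  rewrite cE divr_ge0 ?sqr_ge0 //.
  by have := expR_ge1Dx (lambda * m); lra.
set x := (1 + _) ^+ k in Ebw *.
have Mx : M x by apply: subalgebraX => //; apply: subalgebraD => //;
  exact: subalgebraZ.
have Mw2 : M (w ^+ 2) by exact: subalgebraX.
have Mb2 : M (b ^+ 2) by exact: subalgebraX.
have Mlb : M (lambda%:C *: b) by exact: subalgebraZ.
have Mcb : M (c%:C *: b ^+ 2) by exact: subalgebraZ.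
have M1b : M (1 + lambda%:C *: b) by exact: subalgebraD.
rewrite trace_mul_ce //.
apply: (@le_trans _ _ ((1 + c * sigma ^+ 2) * t (w ^+ 2))); last first.
  apply: ler_wpM2r; last exact: expR_ge1Dx.
  apply: (trace_ge0 tau_nft) => //.
  by rewrite expr2; exact: op_ge0_adjoint_mul.
apply: trace_mul_le => //; first exact: EM.
have : op_le (E x) (E (1 + lambda%:C *: b + c%:C *: b ^+ 2)).
  apply: ce_le => //; first exact: subalgebraD.
  by rewrite cE; apply: power_le_quadratic.
rewrite !ceD // !ceZ // Eb0 scaler0 addr0 (ce1 E_ce) => h1 u.
have -> : (1 + c * sigma ^+ 2)%:C *: (1 : B) - E x =
   (1 + c%:C *: E (b ^+ 2) - E x) + c%:C *: ((sigma ^+ 2)%:C *: (1 : B) - E (b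
     ^+ 2)).
  rewrite rmorphD scalerDl rmorph1 scale1r rmorphM -scalerA scalerBr.
  by rewrite [RHS]addrC addrA (addrC 1 (_ *: E _)) addrA subrK (addrC 1).
rewrite op_addE op_scaleE linearDl /= addr_ge0 ?h1 //.
rewrite linearZl_LR mulr_ge0 ?lecR //; exact: Eb2.
Qed.

End ConditionalExpectation.

(** * The Laplace transform of the sum *)

Section GoldenThompson.
Context {R : realType} {H : hilbertType R}.
Local Notation B := (bounded_operator H).
Implicit Types (S b : B) (lambda K L : R).
Variables (M : set B) (tau : B -> R[i]).
Hypothesis M_vna : von_neumann_algebra M.
Hypothesis tau_nft : normal_faithful_tracial_state M tau.
Local Notation t := (trace tau).
Let sM : subalgebra M := von_neumann_subalgebra M_vna.

(** The Euler approximation of [e^(lambda S)] is its power of exponent [2^p];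
    powers of two are what [trace_power] handles. *)
Definition exp_approx lambda p S : B := 1 + (lambda / (2 ^ p)%:R)%:C *: S.

Lemma exp_approx_sub lambda p S A : subalgebra A -> A S ->
  A (exp_approx lambda p S).
Proof.
move=> sA AS; apply: subalgebraD => //; first exact: subalgebra1.
exact: subalgebraZ.
Qed.

Lemma exp_approx_sa lambda p S : self_adjoint S ->
  self_adjoint (exp_approx lambda p S).
Proof. by move=> sS; apply: is_adjointD; [exact: is_adjoint1|exact:
  is_adjointZ]. Qed.

Lemma golden_thompson_approx S b lambda K L p : M S -> M b ->
  self_adjoint S -> self_adjoint b -> 0 <= lambda -> 0 <= K -> 0 <= L ->
  bounded_by S K -> bounded_by b L ->
  t (exp_approx lambda p (S + b) ^+ (2 ^ p)) <=
  t (exp_approx lambda p b ^+ (2 ^ p) * exp_approx lambda p S ^+ (2 ^ p)) +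
  expR (lambda * (K + L)) * (lambda ^+ 2 * (K * L)) / (2 ^ p)%:R.
Proof.
move=> MS Mb sS sb l0 K0 L0 SK bL.
have N0 : (0 : R) < (2 ^ p)%:R by rewrite ltr0n expn_gt0.
have MX := exp_approx_sub lambda p sM.
have XS := MX _ MS. have Xb := MX _ Mb. have XSb := MX _ (subalgebraD sM MS Mb).
have MP x : M x -> M (x ^+ (2 ^ p)) by exact: subalgebraX.
have h0 : 0 <= lambda / (2 ^ p)%:R by rewrite divr_ge0.
have MXY := MP _ (subalgebraM sM XS Xb).
have := trace_bound M_vna tau_nft (subalgebraB sM (MP _ XSb) MXY)
  (power_product_diff (2 ^ p) h0 K0 L0 SK bL).
rewrite (traceB M_vna tau_nft) //; last exact: MP.
rewrite lerBlDl => /le_trans; apply; apply: lerD.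
  rewrite (traceC tau_nft); [|exact: MP|exact: MP].
  have [_ GT] := trace_power M_vna tau_nft p.
  by apply: GT => //; exact: exp_approx_sa.
set e := expR _; set e' := expR _.
have -> : e = e' by rewrite /e /e' mulrA mulrCA mulfV ?mulr1 ?gt_eqF.
by rewrite le_eqVlt; apply/orP; left; apply/eqP; field; rewrite gt_eqF.
Qed.

End GoldenThompson.

Section Iteration.
Context {R : realType} {H : hilbertType R}.
Local Notation B := (bounded_operator H).
Variables (M N : set B) (tau : B -> R[i]) (E : B -> B).
Hypothesis M_vna : von_neumann_algebra M.
Hypothesis tau_nft : normal_faithful_tracial_state M tau.
Hypothesis N_vna : von_neumann_algebra N.
Hypothesis N_sub_M : N `<=` M.
Hypothesis E_ce : conditional_expectation M N tau E.
Variables (n : nat) (A : 'I_n -> set B) (a : 'I_n -> B) (sigma : 'I_n ->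
  R) (m lambda : R).
Hypothesis A_vna : forall j, von_neumann_algebra (A j).
Hypothesis A_sub_M : forall j, A j `<=` M.
Hypothesis A_indep : successively_independent E A.
Hypothesis a_in_A : forall j, A j (a j).
Hypothesis a_sa : forall j, self_adjoint (a j).
Hypothesis a_mean : forall j, E (a j) = 0.
Hypothesis a_var : forall j, op_le (E (a j ^+ 2)) ((sigma j ^+ 2)%:C *: (1 :
  B)).
Hypothesis m_gt0 : 0 < m.
Hypothesis a_bound : forall j, bounded_by (a j) m.
Hypothesis lambda_ge0 : 0 <= lambda.

Local Notation t := (trace tau).
Let sM : subalgebra M := von_neumann_subalgebra M_vna.
Let S (k : nat) : B := \sum_(i < n | (i < k)%N) a i.
Let V (k : nat) : R := \sum_(i < n | (i < k)%N) sigma i ^+ 2.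
Let c : R := (expR (lambda * m) - 1 - lambda * m) / m ^+ 2.

Let MS k : M (S k).
Proof. by apply: subalgebra_sum => // i _; exact/A_sub_M/a_in_A. Qed.

Let sS k : self_adjoint (S k).
Proof.
rewrite /S; elim/big_ind: _ => [|x y|i _]; [exact: self_adjoint0|exact:
  is_adjointD|exact: a_sa].
Qed.

Lemma big_ord_ltS (T : nmodType) (F : 'I_n -> T) (k : 'I_n) :
  \sum_(i < n | (i < k.+1)%N) F i = \sum_(i < n | (i < k)%N) F i + F k.
Proof.
rewrite (bigD1 k) //= addrC; congr (_ + _); apply: eq_bigl => i.
by rewrite ltnS leq_eqVlt -val_eqE /=; case: ltngtP.
Qed.

(** The constant [D] collects the errors of [golden_thompson_approx] over the
    [k] steps and does not depend on [p].  The exponent is [2^p.+1] so that the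
    approximations are squares. *)
Lemma trace_exp_approx_le k : (k <= n)%N -> exists D : R,
  forall p, t (exp_approx lambda p.+1 (S k) ^+ (2 ^ p.+1)) <=
    expR (c * V k) + D / (2 ^ p.+1)%:R.
Proof.
elim: k => [_|k IH kn].
  exists 0 => p; rewrite /V /S !big_pred0 //.
  by rewrite /exp_approx scaler0 addr0 expr1n (trace1 tau_nft) mulr0 expR0
    mul0r addr0.
have [D IHD] := IH (ltnW kn).
pose j := Ordinal kn.
have SE : S k.+1 = S k + a j by exact: (big_ord_ltS a j).
have VE : V k.+1 = V k + sigma j ^+ 2 by exact: (big_ord_ltS (fun i =>
  sigma i ^+ 2) j).
have [K K0 SK] := op_bounded (S k).
pose C := expR (lambda * (K + m)) * (lambda ^+ 2 * (K * m)).
exists (expR (c * sigma j ^+ 2) * D + C) => p.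
have Mj : M (a j) by exact/A_sub_M/a_in_A.
rewrite SE VE.
apply: le_trans (golden_thompson_approx _ tau_nft p.+1 (MS k) Mj (sS k) (a_sa j)
  lambda_ge0 K0 (ltW m_gt0) SK (a_bound j)) _ => //.
rewrite -/C mulrDl addrA lerD2r mulrDr expRD -mulrA.
rewrite (mulrC (expR (c * V k))) -mulrDr.
apply: le_trans (ler_wpM2l (expR_ge0 _) (IHD p)).
have wE x : x ^+ (2 ^ p.+1) = (x ^+ (2 ^ p)) ^+ 2 :> B by
  rewrite -exprM -expnSr.
rewrite (wE (exp_approx _ _ (S k))).
have Mw : M (exp_approx lambda p.+1 (S k) ^+ (2 ^ p)).
  by apply: subalgebraX => //; exact: exp_approx_sub.
have N0 : ((2 ^ p.+1)%:R : R) != 0 by rewrite pnatr_eq0 expn_eq0.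
apply: (trace_independent_le M_vna tau_nft N_vna N_sub_M E_ce (m :=
  m) (lambda := lambda)) => //.
- by rewrite divr_ge0.
- by rewrite mulrC divfK.
- exact/is_adjointX/exp_approx_sa.
rewrite -wE -/(exp_approx _ _ _).
(* Independence says nothing at the first step, where S k = 0. *)
have [k0|k0] := posnP k.
  have S0 : S k = 0 by rewrite /S k0 big_pred0.
  rewrite S0 /exp_approx scaler0 addr0 expr1n mulr1 (ce1 E_ce) mulr1 //.
apply: (A_indep (k := j)) => //.
  apply: subalgebraX; first exact/von_neumann_subalgebra/A_vna.
  by apply: exp_approx_sub => //; exact/von_neumann_subalgebra/A_vna.
have gS := generated_subalgebra (\bigcup_(i in [set i : 'I_n | (i < j)%N]) A i).
apply: (subalgebraX gS); apply: (exp_approx_sub _ _ gS).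
apply: (subalgebra_sum gS).
by move=> i ik; apply: sub_generated; exists i => //; exact: a_in_A.
Qed.

End Iteration.

Lemma le_add_div_pow2 (R : realType) (X Y Z : R) : 
  (forall p, X <= Y + Z / (2 ^ p.+1)%:R) -> X <= Y.
Proof.
move=> h; rewrite leNgt; apply/negP => YX.
have d0 : 0 < X - Y by rewrite subr_gt0.
have := h (Num.truncn (Z / (X - Y))).
set p := Num.truncn _.
rewrite -lerBlDl ler_pdivlMr ?ltr0n ?expn_gt0 // -ler_pdivlMl // mulrC leNgt =>
  /negP; apply.
apply: lt_trans (truncnS_gt _) _; rewrite -/p ltr_nat.
exact: ltn_expl.
Qed.

(** * The Chernoff bound and the choice of the parameter *)

Section Chernoff.
Context {R : realType} {H : hilbertType R}.
Local Notation B := (bounded_operator H).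
Variables (M : set B) (tau : B -> R[i]).
Hypothesis M_vna : von_neumann_algebra M.
Hypothesis tau_nft : normal_faithful_tracial_state M tau.
Variables (S : B) (P : set (measurableTypeR R) -> B).
Hypothesis MS : M S.
Hypothesis sS : self_adjoint S.
Hypothesis sm : spectral_measure S P.
Local Notation up t := (P [set` `[t, +oo[%R]).

(** [M] is its own bicommutant. *)
Lemma spectral_projection_in t : M (up t).
Proof.
case: M_vna => _ <- y My; rewrite (spectral_commutant sS sm) //.
by rewrite My.
Qed.

Lemma spectral_projection_ge0 t : op_ge0 (up t).
Proof.
have mI : measurable ([set` `[t, +oo[%R] : set (measurableTypeR R)) by
  exact: measurable_itv.
have [sP PP] := sm_projection sm mI.
by rewrite -PP; exact: op_ge0_adjoint_mul.
Qed.

(** With [K = 2^p.+1], the scalar factor [(1 + lambda t / K)^K] falls short of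
    [e^(lambda t)] by a relative error of order [1 / K], which joins the error
    term [D / K]. *)
Lemma chernoff_bound t lambda (Y D : R) : 0 <= t -> 0 <= lambda ->
  (forall p, trace tau (exp_approx lambda p.+1 S ^+ (2 ^ p.+1)) <=
     Y + D / (2 ^ p.+1)%:R) ->
  expR (lambda * t) * trace tau (up t) <= Y.
Proof.
move=> t0 l0 TY; set Q := trace tau (up t).
have Q0 : 0 <= Q by apply: (trace_ge0 tau_nft);
  [exact: spectral_projection_in|exact: spectral_projection_ge0].
have sM := von_neumann_subalgebra M_vna.
apply: (@le_add_div_pow2 _ _ _ (D + expR (lambda * t) * (lambda * t) ^+ 2 * Q))
  => p.
have h0 : 0 <= lambda / (2 ^ p.+1)%:R by rewrite divr_ge0.
have c0 : 0 <= 1 + lambda / (2 ^ p.+1)%:R * t by rewrite addr_ge0 ?mulr_ge0.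
have MP := spectral_projection_in t.
have := spectral_power_ge sS sm (2 ^ p) h0 (erefl _) c0.
rewrite -expnS => /(trace_le M_vna tau_nft _ _)-/(_ (subalgebraZ sM _ MP)).
move=> /(_ (subalgebraX sM _ (exp_approx_sub lambda p.+1 sM MS))).
rewrite (traceZ M_vna tau_nft) // => /le_trans/(_ (TY p)).
have : expR (lambda * t) * (1 - (lambda * t) ^+ 2 / (2 ^ p.+1)%:R) <=
       (1 + lambda / (2 ^ p.+1)%:R * t) ^+ (2 ^ p.+1).
  by rewrite (mulrAC lambda); apply: expR_le_pow; rewrite ?mulr_ge0 ?expn_gt0.
move=> /(ler_wpM2r Q0)/le_trans h /h {h}.
rewrite -/Q; lra.
Qed.

End Chernoff.

Lemma bigmax_sqr (R : realType) n (m : 'I_n -> R) : (forall j, 0 <= m j) ->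
  \big[Num.max/0]_(j < n) (m j ^+ 2) = (\big[Num.max/0]_(j < n) m j) ^+ 2.
Proof.
move=> m0.
have [//] : \big[Num.max/0]_(j < n) (m j ^+ 2) = (\big[Num.max/0]_(j < n) m j)
  ^+ 2 /\
  0 <= \big[Num.max/0]_(j < n) m j.
elim/big_rec2: _ => [|j x y _ [-> y0]]; first by rewrite expr0n.
split; last by rewrite le_max m0.
by rewrite !maxEle ler_pXn2r ?nnegrE //; case: ifP.
Qed.

(** At this [lambda], [e^(lambda m) = 1 + t m / V]; it minimises the exponent. *)
Lemma bennett_exponent (R : realType) (V m t : R) : 0 < V -> 0 < m -> 0 <= t ->
  let lambda := ln (1 + t * m / V) / m in
  (expR (lambda * m) - 1 - lambda * m) / m ^+ 2 * V - lambda * t =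
  - (V / m ^+ 2 * bennett_phi (t * m / V)).
Proof.
move=> V0 m0 t0 /=; rewrite /bennett_phi divfK ?gt_eqF //.
have x0 : 0 <= t * m / V by rewrite divr_ge0 ?mulr_ge0 // ltW.
rewrite lnK ?posrE; last by lra.
set L := ln _; field; rewrite !gt_eqF //.
Qed.

Theorem theorem0p1 (R : realType) (H : hilbertType R)
  (M : set (bounded_operator H)) (tau : bounded_operator H -> R[i])
  (N : set (bounded_operator H))
  (E : bounded_operator H -> bounded_operator H)
  (n : nat) (A : 'I_n -> set (bounded_operator H))
  (a : 'I_n -> bounded_operator H) (sigma m : 'I_n -> R)
  (P : set (measurableTypeR R) -> bounded_operator H)
  (M_vna : von_neumann_algebra M)
  (tau_nft : normal_faithful_tracial_state M tau)
  (N_vna : von_neumann_algebra N) (N_sub_M : N `<=` M)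
  (E_ce : conditional_expectation M N tau E)
  (A_vna : forall j, von_neumann_algebra (A j))
  (N_sub_A : forall j, N `<=` A j) (A_sub_M : forall j, A j `<=` M)
  (A_indep : successively_independent E A)
  (a_in_A : forall j, A j (a j)) (a_sa : forall j, self_adjoint (a j))
  (sigma_ge0 : forall j, 0 <= sigma j) (m_ge0 : forall j, 0 <= m j)
  (sigma_gt0 : 0 < \sum_(j < n) sigma j ^+ 2)
  (m_gt0 : 0 < \big[Num.max/0]_(j < n) m j)
  (a_mean : forall j, E (a j) = 0)
  (a_var : forall j,
     op_le (E (a j ^+ 2)) ((sigma j ^+ 2)%:C *: (1 : bounded_operator H)))
  (a_norm : forall j, op_norm (a j) <= m j)
  (P_spec : spectral_measure (\sum_(j < n) a j) P) :
  forall t : R, 0 <= t ->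
    tau (P [set` `[t, +oo[%R]) <=
      (expR (- ((\sum_(j < n) sigma j ^+ 2) / \big[Num.max/0]_(j < n) (m j ^+ 2)
                * bennett_phi (t * \big[Num.max/0]_(j < n) m j
                               / \sum_(j < n) sigma j ^+ 2))))%:C.
Proof.
move=> t t0; rewrite bigmax_sqr //.
have a_le j : bounded_by (a j) (\big[Num.max/0]_(j < n) m j).
  by apply: bounded_byW (op_norm_bound (a_norm j)) _; exact: le_bigmax.
move: sigma_gt0 m_gt0 a_le; set V := \sum_(j < n) _; set mx :=
  \big[_/_]_(j < n) _.
move=> V0 m0 a_le.
pose lambda := ln (1 + t * mx / V) / mx.
have l0 : 0 <= lambda.
  by rewrite divr_ge0 ?(ltW m0) // ln_ge0 // lerDl divr_ge0 ?mulr_ge0 // ltW.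
have sumE (T : nmodType) (F : 'I_n -> T) :
    \sum_(i < n | (i < n)%N) F i = \sum_(i < n) F i.
  by apply: eq_bigl => i; rewrite ltn_ord.
have [D] := trace_exp_approx_le M_vna tau_nft N_vna N_sub_M E_ce A_vna A_sub_M
  A_indep a_in_A a_sa a_mean a_var m0 a_le l0 (leqnn n).
rewrite !sumE -/V => TD.
have MS : M (\sum_(j < n) a j).
  by apply: subalgebra_sum => [|i _]; [exact:
    von_neumann_subalgebra|exact/A_sub_M/a_in_A].
have sS : self_adjoint (\sum_(j < n) a j).
  elim/big_ind: _ => [|x y|i _]; [exact: self_adjoint0|exact:
    is_adjointD|exact: a_sa].
have := chernoff_bound M_vna tau_nft MS sS P_spec t0 l0 TD.
have := state_ge0 tau_nft (spectral_projection_in M_vna MS sS P_spec t)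
  (spectral_projection_ge0 P_spec t).
rewrite !lecE /= => /andP[/eqP Im0 _] h.
rewrite Im0 eqxx /= -bennett_exponent // -/lambda expRD expRN.
by rewrite ler_pdivlMr ?expR_gt0 // mulrC.
Qed.
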